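(* Let $A\in\mathbb{C}^{n\times n}$, $B\in\mathbb{C}^{n\times m}$, $C\in\mathbb{C}^{p\times n}$, $D\in\mathbb{C}^{p\times m}$ be such that $\mathcal{M}(z)=C(zI-A)^{-1}B+D$ is a stable proper rational transfer matrix, and let $1\le k\le m$ be an integer. Let $\bar\mu_k(\mathcal{M})$ be the $k$-sparse $\mathcal{H}_\infty$ norm of $\mathcal{M}$, let $\bar\mu_k^{sdp}(\mathcal{M})$ be its semidefinite relaxation, and let $\bar\mu_k^{round}(\mathcal{M})$ be the value produced by the rounding procedure from an optimal solution $W^\star$ of the semidefinite relaxation (all defined in the context). Then $$\bar\mu_k^{round}(\mathcal{M})\ \le\ \bar\mu_k(\mathcal{M})\ \le\ \bar\mu_k^{sdp}(\mathcal{M}).$$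
   Context: For a vector-valued (complex) discrete-time signal $\mathbf{x}=(x_0,x_1,\dots)$ the power semi-norm is $\|\mathbf{x}\|_P^2:=\lim_{N\to\infty}\frac1N\sum_{j=0}^{N-1}x_j^*x_j$; the signals considered are those for which the limits involved exist. For an $m$-channel signal $\mathbf{w}$ with components $\mathbf{w}_1,\dots,\mathbf{w}_m$, $\mathbf{Card}(\mathbf{w})$ is the number of indices $i$ with $\|\mathbf{w}_i\|_P>0$. ''Maximum'' means optimal value (supremum). The $k$-sparse $\mathcal{H}_\infty$ norm: $\bar\mu_k(\mathcal{M})^2$ is the optimal value of: maximize $\|C\mathbf{x}+D\mathbf{w}\|_P^2$ over signals $\mathbf{w},\mathbf{x}$ subject to $x_{j+1}=Ax_j+Bw_j$ for all $j\ge0$, $x_0=0$, $\|\mathbf{w}\|_P^2\le1$, $\mathbf{Card}(\mathbf{w})\le k$. The relaxation: $\bar\mu_k^{sdp}(\mathcal{M})^2$ is the optimal value of the semidefinite program: maximize $$\mathrm{Tr}\left(\begin{bmatrix} C^*C & C^*D \\ D^*C & D^*D \end{bmatrix}\begin{bmatrix} X & R \\ R^* & W \end{bmatrix}\right)$$ over $X\in\mathbb{C}^{n\times n}$, $R\in\mathbb{C}^{n\times m}$, $W\in\mathbb{C}^{m\times m}$ subject to $$X=\begin{bmatrix} A & B \end{bmatrix}\begin{bmatrix} X & R \\ R^* & W \end{bmatrix}\begin{bmatrix} A^* \\ B^* \end{bmatrix},\quad \mathrm{Tr}(W)\le1,\quad \mathbf{1}^T|W|\mathbf{1}\le k,\quad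 \begin{bmatrix} X & R \\ R^* & W \end{bmatrix}\succeq0,$$ where $|W|$ is the entrywise absolute value and $\mathbf{1}$ is the all-ones vector. Rounding procedure: given an optimal solution of this semidefinite program with $W$-block $W^\star$, let $i_1,\dots,i_k$ be (distinct) indices of $k$ largest diagonal entries of $W^\star$ (ties broken arbitrarily), let $E=[e_{i_1}\ \cdots\ e_{i_k}]\in\mathbb{R}^{m\times k}$ with $e_i$ the standard basis of $\mathbb{R}^m$, put $\tilde B=BE$, $\tilde D=DE$, and let $\bar\mu_k^{round}(\mathcal{M}):=\|C(zI-A)^{-1}\tilde B+\tilde D\|_\infty$, the usual $\mathcal{H}_\infty$ norm, i.e. the supremum over the unit circle of the largest singular value of the transfer matrix. *)

(* Defs.v *)
From mathcomp Require Import all_boot all_order all_algebra.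
From mathcomp Require Import all_classical all_reals all_analysis.
From mathcomp Require Import spectral complex.

Set Implicit Arguments.
Unset Strict Implicit.
Unset Printing Implicit Defensive.

Import Order.TTheory GRing.Theory Num.Theory.
Import numFieldNormedType.Exports.

Local Open Scope classical_set_scope.
Local Open Scope sesquilinear_scope.
Local Open Scope ring_scope.

(* The complex field is R[i] for R : realType. In its partial order,
   x <= y says that y - x is a nonnegative real; in particular [x <= 1] forces
   x to be real. [M ^t*] is the conjugate transpose of M. *)

Section Signals.
Variable R : realType.

(* x_j^* x_j is a nonnegative real, so taking its real part loses nothing. *)
Definition avg_power d (x : nat -> 'cV[R[i]]_d) (N : nat) : R :=
  N%:R^-1 * \sum_(j < N) complex.Re (((x j) ^t* *m x j) 0 0).

Definition has_power d (x : nat -> 'cV[R[i]]_d) : Prop :=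
  cvg (avg_power x n @[n --> \oo]).

(* Meaningful under [has_power x]. *)
Definition pnorm d (x : nat -> 'cV[R[i]]_d) : R :=
  Num.sqrt (lim (avg_power x n @[n --> \oo])).

Definition channel d (w : nat -> 'cV[R[i]]_d) (i : 'I_d) : nat -> 'cV[R[i]]_1 :=
  fun j => row i (w j).

Definition Card d (w : nat -> 'cV[R[i]]_d) : nat :=
  #|[set i : 'I_d | 0 < pnorm (channel w i)]%SET|.

End Signals.

Section SparseNorm.
Variables (R : realType) (n m p : nat).
Variables (A : 'M[R[i]]_n) (B : 'M[R[i]]_(n, m)).
Variables (C : 'M[R[i]]_(p, n)) (D : 'M[R[i]]_(p, m)).

Definition output (w : nat -> 'cV[R[i]]_m) (x : nat -> 'cV[R[i]]_n) :
    nat -> 'cV[R[i]]_p :=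
  fun j => C *m x j + D *m w j.

(* Besides the constraints, every limit occurring in the problem is required to
   exist: those of w, of each channel of w, and of the output. *)
Definition sparse_feasible (k : nat)
    (w : nat -> 'cV[R[i]]_m) (x : nat -> 'cV[R[i]]_n) : Prop :=
  [/\ has_power w, (forall i, has_power (channel w i)) & has_power (output w x)]
  /\ [/\ forall j, x j.+1 = A *m x j + B *m w j,
         x 0%N = 0,
         pnorm w ^+ 2 <= 1 &
         (Card w <= k)%N].

Definition mu_sparse (k : nat) : \bar R :=
  sqrte (ereal_sup
    [set v | exists w x,
       sparse_feasible k w x /\ v = (pnorm (output w x) ^+ 2)%:E]).

End SparseNorm.

Section Relaxation.
Variables (R : realType) (n m p : nat).
Variables (A : 'M[R[i]]_n) (B : 'M[R[i]]_(n, m)).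
Variables (C : 'M[R[i]]_(p, n)) (D : 'M[R[i]]_(p, m)).

Definition psd d (M : 'M[R[i]]_d) : Prop :=
  M ^t* = M /\ forall v : 'cV[R[i]]_d, 0 <= (v ^t* *m M *m v) 0 0.

Definition absmx d (M : 'M[R[i]]_d) : 'M[R[i]]_d := map_mx (fun c => `|c|) M.

Definition ones d : 'cV[R[i]]_d := const_mx 1.

Definition sdp_block (X : 'M[R[i]]_n) (Q : 'M[R[i]]_(n, m)) (W : 'M[R[i]]_m) :
    'M[R[i]]_(n + m) :=
  block_mx X Q (Q ^t*) W.

Definition sdp_feasible (k : nat)
    (X : 'M[R[i]]_n) (Q : 'M[R[i]]_(n, m)) (W : 'M[R[i]]_m) : Prop :=
  [/\ X = row_mx A B *m sdp_block X Q W *m col_mx (A ^t*) (B ^t*),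
      \tr W <= 1,
      ((ones m)^T *m absmx W *m ones m) 0 0 <= k%:R &
      psd (sdp_block X Q W)].

(* At feasible points this is the trace of a product of two positive
   semidefinite matrices, hence real: the real part only fixes the type. *)
Definition sdp_objective
    (X : 'M[R[i]]_n) (Q : 'M[R[i]]_(n, m)) (W : 'M[R[i]]_m) : R :=
  complex.Re (\tr (block_mx (C ^t* *m C) (C ^t* *m D) (D ^t* *m C) (D ^t* *m D)
                     *m sdp_block X Q W)).

Definition mu_sdp (k : nat) : \bar R :=
  sqrte (ereal_sup
    [set v | exists X Q W,
       sdp_feasible k X Q W /\ v = (sdp_objective X Q W)%:E]).

Definition sdp_optimal (k : nat)
    (X : 'M[R[i]]_n) (Q : 'M[R[i]]_(n, m)) (W : 'M[R[i]]_m) : Prop :=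
  sdp_feasible k X Q W /\
  forall X' Q' W', sdp_feasible k X' Q' W' ->
    sdp_objective X' Q' W' <= sdp_objective X Q W.

End Relaxation.

Section TransferMatrices.
Variable R : realType.

(* C (zI - A)^-1 B + D as a matrix of rational functions of the indeterminate
   z = 'X. It is proper whatever A, B, C, D are. *)
Definition transfer n m p (A : 'M[R[i]]_n) (B : 'M[R[i]]_(n, m))
    (C : 'M[R[i]]_(p, n)) (D : 'M[R[i]]_(p, m)) :
    'M[{fraction {poly R[i]}}]_(p, m) :=
  let emb q := @tofrac {poly R[i]} (polyC q) in
  map_mx emb C *m invmx ((tofrac 'X)%:M - map_mx emb A) *m map_mx emb B
  + map_mx emb D.

(* y is the value at z of the rational function g, for some representation of g
   without pole at z. The representation is existentially quantified, so
   removable singularities are removed. *)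
Definition rat_value (g : {fraction {poly R[i]}}) (z y : R[i]) : Prop :=
  exists a b : {poly R[i]},
    [/\ b.[z] != 0, g = tofrac a / tofrac b & y = a.[z] / b.[z]].

Definition pole (g : {fraction {poly R[i]}}) (z : R[i]) : Prop :=
  ~ exists y, rat_value g z y.

(* Discrete-time stability: all the poles are in the open unit disc. *)
Definition stable p m (G : 'M[{fraction {poly R[i]}}]_(p, m)) : Prop :=
  forall i j z, pole (G i j) z -> `|z| < 1.

Definition singular_value p m (G : 'M[R[i]]_(p, m)) (s : R) : Prop :=
  0 <= s /\ eigenvalue (G ^t* *m G) ((s ^+ 2)%:C)%C.

(* The supremum of a finite set, nonempty as soon as 0 < m. *)
Definition largest_singular_value p m (G : 'M[R[i]]_(p, m)) : R :=
  sup [set s | singular_value G s].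

Definition hinf_norm p m (G : 'M[{fraction {poly R[i]}}]_(p, m)) : \bar R :=
  ereal_sup
    [set v | exists (z : R[i]) (Gz : 'M[R[i]]_(p, m)),
       [/\ `|z| = 1, forall i j, rat_value (G i j) z (Gz i j) &
           v = (largest_singular_value Gz)%:E]].

End TransferMatrices.

Section Rounding.
Variables (R : realType) (n m p k : nat).

(* idx enumerates k distinct indices of k largest diagonal entries of W; the
   diagonal of a Hermitian matrix is real, so these entries are comparable. *)
Definition top_diag (W : 'M[R[i]]_m) (idx : 'I_k -> 'I_m) : Prop :=
  injective idx /\
  forall (l : 'I_k) (j : 'I_m),
    (forall l', j <> idx l') -> W j j <= W (idx l) (idx l).

Definition selection (idx : 'I_k -> 'I_m) : 'M[R[i]]_(m, k) :=
  \matrix_(i < m, l < k) (i == idx l)%:R.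

Definition mu_round (A : 'M[R[i]]_n) (B : 'M[R[i]]_(n, m))
    (C : 'M[R[i]]_(p, n)) (D : 'M[R[i]]_(p, m)) (idx : 'I_k -> 'I_m) : \bar R :=
  hinf_norm (transfer A (B *m selection idx) C (D *m selection idx)).

End Rounding.

(* Main.v *)
Require Import Defs.
From mathcomp Require Import all_boot all_order all_algebra.
From mathcomp Require Import all_classical all_reals all_analysis.
From mathcomp Require Import spectral complex.
From mathcomp Require Import ring lra generic_quotient.

Set Implicit Arguments.
Unset Strict Implicit.
Unset Printing Implicit Defensive.

Import Order.TTheory GRing.Theory Num.Theory.
Import numFieldNormedType.Exports.
Import Normc.

Local Open Scope classical_set_scope.
Local Open Scope sesquilinear_scope.
Local Open Scope ring_scope.

(** Stability bounds the impulse response [h_s = C A^s B]: writing an entry of the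
transfer matrix as a coprime fraction [a / b], the polynomial [b] annihilates the
sequence [h] and has its roots in the open disc, so [h] is absolutely summable,
even when [A] itself has (hidden) unstable modes.

Lower bound: a right singular vector [u] of the rounded transfer matrix at [z]
gives the sparse input [z^j E u], whose response is asymptotic to [z^j G(z) u].

Upper bound: given a feasible signal, cut [w] at time [N] and close it up with
period [N + M] up to a unimodular factor [c] that is not a [(N + M)]-th power of an
eigenvalue of [A]. The Gram matrices of the resulting trajectory over one period
satisfy the Lyapunov equation exactly. For [M] large the output on [[0, N)] is close
to the given one, by summability of [h], uniformly in [c]; then let [N] tend to
infinity and rescale. *)

(** * Coprime representatives of rational functions *)

Section Fractions.
Local Open Scope quotient_scope.

Lemma fractionP (T : idomainType) (x : {fraction T}) :
  exists a b : T, b != 0 /\ x = tofrac a / tofrac b.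
Proof.
elim/quotW: x => r; exists (frac r).1, (frac r).2; split; first exact: denom_ratioP.
have d0 := denom_ratioP r.
have td0 : tofrac (frac r).2 != 0 by rewrite tofrac_eq0.
apply: (mulIf td0); rewrite divfK //; apply/eqP.
(* Exposing the quotient operations lets [piE] reduce the equality to cross-multiplication of
   representatives. *)
change (FracField.mul (\pi_(FracField.type T) r) (FracField.tofrac (frac r).2)
  == FracField.tofrac (frac r).1).
by rewrite !piE FracField.equivfE /FracField.mulf !numden_Ratio ?oner_eq0 ?mulr1 // mulrC.
Qed.
End Fractions.

Lemma coprime_fractionP (K : fieldType) (x : {fraction {poly K}}) :
  exists a b : {poly K}, [/\ b != 0, coprimep a b & x = tofrac a / tofrac b].
Proof.
have [a [b [b0 ->]]] := fractionP x.
have g0 : gcdp a b != 0 by rewrite gcdp_eq0 (negPf b0) andbF.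
have ga : a %/ gcdp a b * gcdp a b = a by rewrite divpK ?dvdp_gcdl.
have gb : b %/ gcdp a b * gcdp a b = b by rewrite divpK ?dvdp_gcdr.
exists (a %/ gcdp a b), (b %/ gcdp a b); split.
- by apply: contraNneq b0 => e; rewrite -gb e mul0r.
- by apply: coprimep_div_gcd; rewrite b0 orbT.
- have tg0 : tofrac (gcdp a b) != 0 by rewrite tofrac_eq0.
  have ea : tofrac a = tofrac (a %/ gcdp a b) * tofrac (gcdp a b).
    by rewrite -tofracM ga.
  have eb : tofrac b = tofrac (b %/ gcdp a b) * tofrac (gcdp a b).
    by rewrite -tofracM gb.
  by rewrite ea eb -mulf_div divff // mulr1.
Qed.

(** * Moments and the transfer function *)

Section Moments.
Variables (K : fieldType) (n : nat) (A : 'M[K]_n.+1).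

(** On ['X^s] this is the Markov parameter [u A^s v]. Extending it linearly to polynomials turns
    linear recurrences of the impulse response into annihilating polynomials. *)
Definition moment (u : 'rV[K]_n.+1) (v : 'cV[K]_n.+1) (f : {poly K}) : K :=
  (u *m horner_mx A f *m v) 0 0.

Variables (u : 'rV[K]_n.+1) (v : 'cV[K]_n.+1).
Local Notation L := (moment u v).

Lemma momentD f g : L (f + g) = L f + L g.
Proof. by rewrite /moment rmorphD mulmxDr mulmxDl mxE. Qed.

Lemma momentZ c f : L (c *: f) = c * L f.
Proof. by rewrite /moment linearZ /= -scalemxAr -scalemxAl mxE. Qed.

Lemma moment0 : L 0 = 0.
Proof. by rewrite -(scale0r 0) momentZ mul0r. Qed.

Lemma moment_sum (I : Type) (r : seq I) (P : pred I) (F : I -> {poly K}) :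
  L (\sum_(i <- r | P i) F i) = \sum_(i <- r | P i) L (F i).
Proof. exact: (big_morph _ momentD moment0). Qed.

Local Notation F := {fraction {poly K}}.
Local Notation emb := (@tofrac {poly K} \o polyC).

Definition resolvent : 'M[F]_n.+1 := invmx ((tofrac 'X)%:M - map_mx emb A).

Lemma resolventK : ((tofrac 'X)%:M - map_mx emb A) *m resolvent = 1%:M.
Proof.
apply: mulmxV.
have -> : (tofrac 'X)%:M - map_mx emb A = map_mx (@tofrac {poly K}) (char_poly_mx A).
  by rewrite /char_poly_mx map_mxB map_scalar_mx /= map_mx_comp.
by rewrite unitmxE det_map_mx unitfE tofrac_eq0 (monic_neq0 (char_poly_monic A)).
Qed.

Definition resolvent_moment (f : {poly K}) : F :=
  (map_mx emb (u *m horner_mx A f) *m resolvent *m map_mx emb v) 0 0.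
Local Notation r := resolvent_moment.

Lemma resolvent_momentD f g : r (f + g) = r f + r g.
Proof. by rewrite /r rmorphD mulmxDr map_mxD !mulmxDl mxE. Qed.

Lemma resolvent_momentZ c f : r (c *: f) = emb c * r f.
Proof. by rewrite /r linearZ /= -scalemxAr map_mxZ -!scalemxAl mxE. Qed.

Lemma resolvent_moment0 : r 0 = 0.
Proof. by rewrite -(scale0r 0) resolvent_momentZ rmorph0 mul0r. Qed.

Lemma resolvent_moment_sum (I : Type) (s : seq I) (P : pred I) (G : I -> {poly K}) :
  r (\sum_(i <- s | P i) G i) = \sum_(i <- s | P i) r (G i).
Proof. exact: (big_morph _ resolvent_momentD resolvent_moment0). Qed.

(** Since (X - A) times the resolvent is 1, multiplying the resolvent by A amounts to multiplying it
    by X and subtracting the identity. *)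
Lemma resolvent_momentMX f : r (f * 'X) = tofrac 'X * r f - emb (L f).
Proof.
have e : r (f * 'X) - tofrac 'X * r f = - emb (L f).
  rewrite /r rmorphM /= horner_mx_X mulmxA [X in X *m _ *m _]map_mxM.
  set w := map_mx emb (u *m horner_mx A f).
  have -> : tofrac 'X * (w *m resolvent *m map_mx emb v) 0 0
      = (w *m (tofrac 'X)%:M *m resolvent *m map_mx emb v) 0 0.
    by rewrite mul_mx_scalar -!scalemxAl [in RHS]mxE.
  have sub (M N : 'M[F]_1) : M 0 0 - N 0 0 = (M - N) 0 0 by rewrite !mxE.
  rewrite sub.
  rewrite -!mulmxBl -mulmxBr -opprB mulmxN !mulNmx -[w *m _ *m _]mulmxA.
  rewrite resolventK mulmx1.
  by rewrite mxE -map_mxM mxE.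
by rewrite -e addrC subrK.
Qed.

(** The subtracted sum is the polynomial part of X^l times the expansion of [r 1] at infinity, whose
    coefficients are the Markov parameters. *)
Lemma resolvent_momentXn l :
  r 'X^l = tofrac 'X^l * r 1 - tofrac (\sum_(i < l) L 'X^i *: 'X^(l - i.+1)).
Proof.
elim: l => [|l IH]; first by rewrite big_ord0 tofrac0 subr0 tofrac1 mul1r.
rewrite exprSr resolvent_momentMX IH big_ord_recr /= subnn expr0 tofracD.
rewrite [tofrac ('X^l * _)]tofracM.
have -> : \sum_(i < l) L 'X^i *: 'X^(l.+1 - i.+1) =
    'X * \sum_(i < l) L 'X^i *: 'X^(l - i.+1).
  rewrite big_distrr /=; apply: eq_bigr => i _.
  by rewrite subSn // exprS scalerAr.
rewrite tofracM -[L 'X^l *: 1]mul_polyC mulr1.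
by ring.
Qed.

Lemma resolvent_moment_poly f :
  r f = tofrac f * r 1
        - tofrac (\sum_(l < size f) f`_l *: \sum_(i < l) L 'X^i *: 'X^(l - i.+1)).
Proof.
rewrite -{1 2}[f]coefK poly_def resolvent_moment_sum !rmorph_sum /= mulr_suml -sumrB.
apply: eq_bigr => l _.
rewrite resolvent_momentZ resolvent_momentXn mulrBr -!mul_polyC !tofracM.
by rewrite mulrA.
Qed.

Lemma resolvent_moment_char f : r (char_poly A * f) = 0.
Proof.
by rewrite /r rmorphM /= Cayley_Hamilton mul0r mulmx0 map_mx0 !mul0mx mxE.
Qed.

Section Annihilator.
Variables (b t1 : {poly K}).
Hypothesis rb : r b = tofrac t1.

(** Building [f] up by Horner's scheme, each multiplication by X only subtracts a constant, so
    polynomiality propagates from [r b]. *)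
Lemma resolvent_moment_annihilator_poly f : exists t, r (b * f) = tofrac t.
Proof.
elim/poly_ind: f => [|f c [t IH]].
  by exists 0; rewrite mulr0 resolvent_moment0 tofrac0.
exists ('X * t - (L (b * f))%:P + c *: t1).
rewrite mulrDr mulrA resolvent_momentD resolvent_momentMX IH.
rewrite [b * c%:P]mulrC mul_polyC resolvent_momentZ rb.
by rewrite !rmorphD rmorphM rmorphN /= -mul_polyC tofracM.
Qed.

(* Multiplication by [g] commutes with [f |-> r (b * f)] up to lower degree. *)
Lemma resolvent_moment_annihilator_lead g f t s :
  r (b * f) = tofrac t -> r (b * f * g) = tofrac s ->
  (size (s - g * t)%R <= (size g).-1)%N.
Proof.
move=> rt; elim/poly_ind: g s => [|g c IH] s rs.
  move/eqP: rs; rewrite mulr0 resolvent_moment0 eq_sym tofrac_eq0 => /eqP ->.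
  by rewrite mul0r subr0 size_poly0.
have [s' rs'] := resolvent_moment_annihilator_poly (f * g).
rewrite mulrA in rs'.
have es : s = 'X * s' - (L (b * f * g))%:P + c *: t.
  apply/eqP; rewrite -tofrac_eq -rs; apply/eqP.
  rewrite mulrDr mulrA resolvent_momentD resolvent_momentMX rs'.
  rewrite [_ * c%:P]mulrC mul_polyC resolvent_momentZ rt.
  by rewrite !rmorphD rmorphM rmorphN /= -mul_polyC tofracM.
have [g0|g0] := eqVneq g 0.
  have s'0 : s' = 0.
    apply/eqP; rewrite -tofrac_eq0 -rs' g0 mulr0 resolvent_moment0 //.
  rewrite es s'0 g0 !mulr0 moment0 polyC0 mul0r subr0 !add0r mul_polyC subrr.
  by rewrite size_poly0.
rewrite size_MXaddC (negPf g0) /=.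
have -> : s - (g * 'X + c%:P) * t = (s' - g * t) * 'X - (L (b * f * g))%:P.
  by rewrite es -mul_polyC; ring.
apply: leq_trans (size_polyD _ _) _; rewrite geq_max; apply/andP; split.
  have := IH _ rs'; have [->|e0] := eqVneq (s' - g * t) 0.
    by rewrite mul0r size_poly0.
  by rewrite size_mulX // => /leq_ltn_trans; apply; rewrite ltn_predL size_poly_gt0.
by rewrite size_polyN (leq_trans (size_polyC_leq1 _)) // size_poly_gt0.
Qed.

(** A strictly proper rational function that is a polynomial must vanish. Here properness is a
    degree count: for g the characteristic polynomial, [r (b * f * g)] is 0 by Cayley-Hamilton, so
    the size of g t is less than that of g. *)
Lemma resolvent_moment_annihilator f : r (b * f) = 0.
Proof.
have [t rt] := resolvent_moment_annihilator_poly f.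
rewrite rt; apply/eqP; rewrite tofrac_eq0; apply/negPn/negP => t0.
have := @resolvent_moment_annihilator_lead (char_poly A) f t 0 rt.
rewrite [_ * char_poly A]mulrC resolvent_moment_char tofrac0 => /(_ erefl).
rewrite sub0r size_polyN size_monicM ?char_poly_monic // size_char_poly /=.
by rewrite -[X in (_ <= X)%N]addn0 leq_add2l leqn0 size_poly_eq0 (negPf t0).
Qed.

Lemma moment_annihilator f : L (b * f) = 0.
Proof.
have := resolvent_momentMX (b * f).
rewrite -mulrA !resolvent_moment_annihilator mulr0 sub0r => /eqP.
by rewrite eq_sym oppr_eq0 tofrac_eq0 polyC_eq0 => /eqP.
Qed.
End Annihilator.

(* [r 1] is the transfer function [u (X - A)^-1 v]. *)
Lemma transfer_numden (a b : {poly K}) (d : K) : b != 0 ->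
  tofrac a / tofrac b = r 1 + emb d ->
  (forall f, L (b * f) = 0) /\
  a = d *: b + \sum_(l < size b) b`_l *: \sum_(i < l) L 'X^i *: 'X^(l - i.+1).
Proof.
move=> b0 e.
have tb0 : tofrac b != 0 by rewrite tofrac_eq0.
have e1 : tofrac b * r 1 = tofrac (a - d *: b).
  rewrite tofracB -mul_polyC tofracM; apply/eqP.
  rewrite -subr_eq0; apply/eqP.
  have -> : r 1 = tofrac a / tofrac b - emb d by rewrite e addrK.
  by rewrite mulrBr mulrCA divff // mulr1 /=; ring.
(* Clearing the denominator made [tofrac b * r 1] a polynomial, hence so is [r b]. It therefore
   vanishes, and its vanishing is the formula for [a]. *)
have := resolvent_moment_poly b; rewrite e1 -tofracB => rb.
split; first exact: moment_annihilator rb.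
have /eqP := resolvent_moment_annihilator rb 1.
rewrite mulr1 rb tofrac_eq0 subr_eq0 subr_eq => /eqP ->.
by rewrite addrC.
Qed.

End Moments.

(** * Summability of the impulse response *)

Lemma bounded_series_tail (R : realType) (e : nat -> R) (M : R) :
  (forall i, 0 <= e i) -> (forall N : nat, \sum_(i < N) e i <= M) ->
  forall eps : R, 0 < eps ->
  exists l0 : nat, forall l : nat, (l0 <= l)%N ->
    forall N : nat, \sum_(i < N) e (l + i)%N <= eps.
Proof.
move=> e0 eM eps eps0.
pose S := [set x | exists N : nat, x = \sum_(i < N) e i].
have hS : has_sup S.
  split; first by exists (\sum_(i < 0) e i), 0%N.
  by exists M => x [N ->]; exact: eM.
have [x [l0 ->] hl0] := sup_adherent eps0 hS.
have mono (a c : nat) : (a <= c)%N -> \sum_(i < a) e i <= \sum_(i < c) e i.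
  move=> ac; rewrite -(subnKC ac) big_split_ord /= lerDl.
  by apply: sumr_ge0 => i _; exact: e0.
exists l0 => l ll N.
have : \sum_(i < l + N) e i <= sup S.
  by apply: sup_upper_bound => //; exists (l + N)%N.
rewrite big_split_ord /= => h.
have := mono _ _ ll => h2.
lra.
Qed.

Section Decay.
Variable R : realType.
Local Notation K := R[i].

Lemma normcE_re (x : K) : `|x| = (normc x)%:C%C.
Proof. by []. Qed.

Lemma normc_ge0 (x : K) : 0 <= normc x.
Proof. by rewrite -ler0c -normcE_re. Qed.

Lemma normcX1 (z : K) (t : nat) : normc z = 1 -> normc (z ^+ t) = 1.
Proof.
by move=> z1; elim: t => [|t IH]; rewrite ?expr0 ?normc1 // exprS normcM z1 IH mulr1.
Qed.

Lemma normc_sum (I : Type) (r : seq I) (P : pred I) (F : I -> K) :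
  normc (\sum_(i <- r | P i) F i) <= \sum_(i <- r | P i) normc (F i).
Proof.
elim/big_rec2: _ => [|i y x _ h]; first by rewrite normc0.
by apply: le_trans (le_normcD _ _) _; rewrite lerD2l.
Qed.

(** In lowest terms every root of the denominator is a pole: a pole-free representation a'/b' would
    give a b' = a' b, making the root common to [a] and [b]. *)
Lemma stable_fraction (g : {fraction {poly K}}) :
  (forall z, pole g z -> `|z| < 1) ->
  exists a b : {poly K}, [/\ b != 0, g = tofrac a / tofrac b &
    forall z, root b z -> `|z| < 1].
Proof.
move=> st; have [a [b [b0 cab eg]]] := coprime_fractionP g.
exists a, b; split => // z bz; apply: st => -[y [a' [b' [b'z eg' _]]]].
have b'0 : b' != 0 by apply: contraNneq b'z => ->; rewrite horner0.
have : a * b' = a' * b.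
  have tb : tofrac b != 0 by rewrite tofrac_eq0.
  have tb' : tofrac b' != 0 by rewrite tofrac_eq0.
  have := eqr_div (tofrac a) (tofrac a') tb tb'.
  by rewrite -eg -eg' eqxx -!tofracM tofrac_eq => /esym/eqP.
move/(congr1 (horner^~ z)); rewrite !hornerM (rootP bz) mulr0 => /eqP.
rewrite mulf_eq0 (negPf b'z) orbF => az.
by move/coprimep_root: cab => /(_ z az); rewrite (rootP bz) eqxx.
Qed.

Section Functional.
Variables (n : nat) (A : 'M[K]_n.+1) (u : 'rV[K]_n.+1) (v : 'cV[K]_n.+1).
Local Notation L := (moment A u v).

(** Induction on the roots, repeated ones included. Removing a root x leaves a first-order recursion
    with ratio x and a summable forcing term; summing it gives (1 - |x|) T <= |L f| + M for every
    partial sum T. *)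
Lemma moment_summable (rs : seq K) (f : {poly K}) :
  (forall x, x \in rs -> `|x| < 1) ->
  (forall g, L (\prod_(x <- rs) ('X - x%:P) * f * g) = 0) ->
  exists M : R, forall N : nat, \sum_(i < N) normc (L ('X^i * f)) <= M.
Proof.
elim: rs f => [|x rs IH] f hrs h0.
  exists 0 => N; rewrite big1 // => i _.
  by have := h0 'X^i; rewrite big_nil mul1r mulrC => ->; rewrite normc0.
have hrs' y : y \in rs -> `|y| < 1 by move=> yr; apply: hrs; rewrite inE yr orbT.
have h0' g : L (\prod_(x <- rs) ('X - x%:P) * (('X - x%:P) * f) * g) = 0.
  by rewrite -[RHS](h0 g) big_cons; congr moment; ring.
have [M hM] := IH _ hrs' h0'.
have x1 : normc x < 1 by rewrite -ltcR -normcE_re; apply: hrs; rewrite inE eqxx.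
have x0 := normc_ge0 x.
exists ((normc (L f) + M) / (1 - normc x)) => N.
rewrite ler_pdivlMr ?subr_gt0 //.
pose T N := \sum_(i < N) normc (L ('X^i * f)).
have TS : T N.+1 <= normc (L f) + (normc x * T N + M).
  rewrite /T big_ord_recl expr0 mul1r lerD2l.
  apply: le_trans (lerD (lexx _) (hM N)).
  rewrite mulr_sumr -big_split; apply: ler_sum => i _ /=.
  rewrite -normcM -momentZ.
  have -> : 'X^(bump 0 i) * f = x *: ('X^i * f) + 'X^i * (('X - x%:P) * f).
    by rewrite -mul_polyC /bump /= add1n exprS; ring.
  by rewrite momentD le_normcD.
have TT : T N <= T N.+1.
  by rewrite /T big_ord_recr /= lerDl normc_ge0.
rewrite -/(T N); nra.
Qed.

Variable b : {poly K}.
Hypothesis b0 : b != 0.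
Hypothesis b_roots : forall z, root b z -> `|z| < 1.
Hypothesis Lb : forall f, L (b * f) = 0.

Lemma annihilated_moment_summable f :
  exists M : R, forall N : nat, \sum_(i < N) normc (L ('X^i * f)) <= M.
Proof.
have [rs hb] := closed_field_poly_normal b.
have lb0 : lead_coef b != 0 by rewrite lead_coef_eq0.
apply: (@moment_summable rs) => [x xr|g].
  apply: b_roots; rewrite hb rootZ // root_prod_XsubC //.
apply: (mulfI lb0); rewrite -momentZ mulr0 -[RHS](Lb (f * g)) [in RHS]hb.
by congr moment; rewrite -!mul_polyC; ring.
Qed.

Lemma annihilated_moment_tail f (eps : R) : 0 < eps ->
  exists l0 : nat, forall l : nat, (l0 <= l)%N ->
    forall N : nat, \sum_(i < N) normc (L ('X^(l + i) * f)) <= eps.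
Proof.
move=> eps0; have [M hM] := annihilated_moment_summable f.
have e0 i : 0 <= normc (L ('X^i * f)) by exact: normc_ge0.
exact: bounded_series_tail e0 hM eps eps0.
Qed.

Lemma annihilated_moment_small f (eps : R) : 0 < eps ->
  exists l0 : nat, forall l : nat, (l0 <= l)%N -> normc (L ('X^l * f)) <= eps.
Proof.
move=> /(annihilated_moment_tail f) [l0 h]; exists l0 => l /h /(_ 1%N).
by rewrite big_ord1 addn0.
Qed.

(* Unrolling [c s_l = s_(l+P) + L 'X^l] bounds [s_l] by a tail of the impulse
   response, uniformly in the period [P]. *)
Lemma periodic_moment_small (l0 : nat) (eps : R) :
  (forall l : nat, (l0 <= l)%N ->
    forall N : nat, \sum_(i < N) normc (L ('X^(l + i) * 1)) <= eps) ->
  forall (P : nat) (c : K) (q : {poly K}), (0 < P)%N -> normc c = 1 ->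
    (forall f, L ((c%:P - 'X^P) * q * f) = L f) ->
    forall l : nat, (l0 <= l)%N -> normc (L ('X^l * q)) <= eps.
Proof.
move=> tail P c q P0 c1 Lq l ll.
have step l' : normc (L ('X^l' * q)) <= normc (L ('X^l' * 1)) + normc (L ('X^(l' + P) * q)).
  rewrite -[leLHS]mul1r -c1 -normcM -momentZ.
  have -> : L (c *: ('X^l' * q)) = L ('X^l' * 1) + L ('X^(l' + P) * q).
    rewrite mulr1 -(Lq 'X^l') -momentD; congr moment.
    by rewrite -mul_polyC exprD; ring.
  exact: le_normcD.
have unroll T : normc (L ('X^l * q)) <=
    \sum_(i < T * P) normc (L ('X^(l + i) * 1)) + normc (L ('X^(l + T * P) * q)).
  elim: T => [|T IH]; first by rewrite mul0n big_ord0 add0r addn0.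
  apply: le_trans IH _; rewrite mulSnr big_split_ord /= -addrA lerD2l.
  apply: le_trans (step _) _; rewrite addnA lerD2r.
  rewrite (bigD1 (Ordinal P0)) //= addn0 lerDl.
  by apply: sumr_ge0 => i _; exact: normc_ge0.
apply/ler_addgt0Pr => d d0.
(* The remainder after T periods tends to 0 for this fixed [q], so it leaves no trace in the final
   bound. As P >= 1, [T0] periods reach past the threshold. *)
have [T0 hT] := annihilated_moment_small q d0.
apply: le_trans (unroll T0) _; apply: lerD; first exact: tail.
by apply: hT; rewrite (leq_trans (leq_pmulr T0 P0)) // leq_addl.
Qed.

End Functional.
End Decay.

(** * Frequency response and the resolvent of a periodic closure *)

Section Transfer.
Variable R : realType.
Local Notation K := R[i].

Lemma transferE (n m p : nat) (A : 'M[K]_n.+1) (B : 'M[K]_(n.+1, m))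
    (C : 'M[K]_(p, n.+1)) (D : 'M[K]_(p, m)) i j :
  transfer A B C D i j =
    resolvent_moment A (row i C) (col j B) 1 + tofrac (D i j)%:P.
Proof.
rewrite /transfer /resolvent_moment rmorph1 mulmx1 mxE [X in _ + X]mxE; congr (_ + _).
rewrite /resolvent !mxE; apply: eq_bigr => k _; rewrite !mxE; congr (_ * _).
by apply: eq_bigr => l _; rewrite !mxE.
Qed.

Lemma momentE (n m p : nat) (A : 'M[K]_n.+1) (B : 'M[K]_(n.+1, m))
    (C : 'M[K]_(p, n.+1)) i j f :
  moment A (row i C) (col j B) f = (C *m horner_mx A f *m B) i j.
Proof.
by rewrite /moment -!row_mul !mxE; apply: eq_bigr => k _; rewrite !mxE.
Qed.

Lemma stable_moments (n m p : nat) (A : 'M[K]_n.+1) (B : 'M[K]_(n.+1, m))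
    (C : 'M[K]_(p, n.+1)) (D : 'M[K]_(p, m)) i j
    (L := moment A (row i C) (col j B)) :
  stable (transfer A B C D) ->
  exists a b : {poly K}, [/\ b != 0,
    transfer A B C D i j = tofrac a / tofrac b,
    forall z, root b z -> `|z| < 1,
    forall f, L (b * f) = 0 &
    a = D i j *: b + \sum_(l < size b) b`_l *: \sum_(s < l) L 'X^s *: 'X^(l - s.+1)].
Proof.
move=> /(_ i j) st; have [a [b [b0 e hb]]] := stable_fraction st.
have := e; rewrite transferE => /esym h.
by have [h1 h2] := transfer_numden b0 h; exists a, b; split.
Qed.

Lemma rat_value_uniq (a b : {poly K}) (z y : K) : b.[z] != 0 ->
  rat_value (tofrac a / tofrac b) z y -> y = a.[z] / b.[z].
Proof.
move=> bz [a' [b' [b'z e ->]]].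
have nz (q : {poly K}) : q.[z] != 0 -> tofrac q != 0.
  by move=> qz; rewrite tofrac_eq0; apply: contraNneq qz => ->; rewrite horner0.
have /eqP := e; rewrite eqr_div ?nz // -!tofracM tofrac_eq => /eqP.
move/(congr1 (horner^~ z)); rewrite !hornerM => h.
by apply/eqP; rewrite eqr_div // h.
Qed.

(** The parenthesized factor is the output at time t for the input z^j. So b(z) times its distance
    to the steady state is a fixed combination of finitely many values of [h] from time t on. The
    step from t to t + 1 multiplies both sides by z and subtracts b(z) h_t. *)
Lemma remainder_recurrence (b : {poly K}) (d z : K) (h : nat -> K) :
  (forall t : nat, \sum_(l < size b) b`_l * h (t + l)%N = 0) ->
  let a := d *: b + \sum_(l < size b) b`_l *: \sum_(s < l) h s *: 'X^(l - s.+1) in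
  forall t : nat,
  z ^+ t * a.[z] - b.[z] * (z ^+ t * d + \sum_(s < t) z ^+ (t - s.+1) * h s) =
  \sum_(l < size b) b`_l * \sum_(s < l) z ^+ (l - s.+1) * h (t + s)%N.
Proof.
move=> hb a.
elim=> [|t IH].
  rewrite expr0 !mul1r big_ord0 addr0 /a hornerD hornerZ addrAC mulrC subrr add0r.
  rewrite horner_sum; apply: eq_bigr => l _; rewrite hornerZ horner_sum; congr (_ * _).
  by apply: eq_bigr => s _; rewrite hornerZ hornerXn mulrC.
have -> : \sum_(s < t.+1) z ^+ (t.+1 - s.+1) * h s =
    z * \sum_(s < t) z ^+ (t - s.+1) * h s + h t.
  rewrite big_ord_recr /= subnn mul1r mulr_sumr; congr (_ + _).
  by apply: eq_bigr => s _; rewrite subSn // exprS mulrA.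
transitivity (z * (z ^+ t * a.[z] - b.[z] * (z ^+ t * d + \sum_(s < t) z ^+ (t - s.+1) * h s))
    - b.[z] * h t); first by rewrite exprS; ring.
(* The recurrence [hb t] is added as a zero: it supplies the last term h (t + l) of each shifted
   window. *)
rewrite IH horner_coef mulr_suml mulr_sumr -[LHS]addr0 -[X in _ + X](hb t).
rewrite -sumrB -big_split; apply: eq_bigr => l _ /=.
have e : z * \sum_(s < l) z ^+ (l - s.+1) * h (t + s)%N + h (t + l)%N =
    z ^+ l * h t + \sum_(s < l) z ^+ (l - s.+1) * h (t.+1 + s)%N.
  transitivity (\sum_(s < l.+1) z ^+ (l - s) * h (t + s)%N).
    rewrite big_ord_recr /= subnn mul1r mulr_sumr; congr (_ + _).
    by apply: eq_bigr => s _; rewrite mulrA -exprS subnSK.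
  rewrite big_ord_recl /= subn0 addn0; congr (_ + _).
  by apply: eq_bigr => s _; rewrite /bump /= add1n addnS addSn.
transitivity (b`_l * ((z * \sum_(s < l) z ^+ (l - s.+1) * h (t + s)%N + h (t + l)%N)
    - z ^+ l * h t)).
  by ring.
by rewrite e addrC addKr.
Qed.

(** The remainder of [remainder_recurrence] tends to 0 with the impulse response, and b(z) is
    nonzero because the roots of [b] lie inside the open disc. *)
Lemma frequency_response (n m p : nat) (A : 'M[K]_n) (B : 'M[K]_(n, m))
    (C : 'M[K]_(p, n)) (D : 'M[K]_(p, m)) i j (z y : K) :
  stable (transfer A B C D) -> normc z = 1 ->
  rat_value (transfer A B C D i j) z y ->
  forall eps : R, 0 < eps -> exists t0 : nat, forall t : nat, (t0 <= t)%N ->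
  normc (z ^+ t * D i j + \sum_(s < t) z ^+ (t - s.+1) * (C *m A ^+ s *m B) i j
         - z ^+ t * y) <= eps.
Proof.
(* Moments require a nonempty state space; with an empty one the transfer matrix is the constant
   [D]. *)
case: n A B C => [|n] A B C st z1 ry eps eps0.
  exists 0%N => t _; rewrite big1 => [|s _]; last first.
    by rewrite (thinmx0 C) !mul0mx mxE mulr0.
  have : rat_value (tofrac (D i j)%:P / tofrac 1) z y.
    rewrite tofrac1 divr1; move: ry; rewrite /transfer [map_mx _ C]thinmx0 !mul0mx add0r.
    by rewrite mxE.
  move/rat_value_uniq; rewrite !hornerE oner_eq0 divr1 => /(_ isT) ->.
  by rewrite subrr normc0 ltW.
have [a [b [b0 e hb Lb ha]]] := stable_moments i j st.
have bz : b.[z] != 0.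
  apply/negP => /hb; rewrite normcE_re z1 ltxx //.
have {}ry := rat_value_uniq bz (eq_ind _ (fun g => rat_value g z y) ry _ e).
pose h s := (C *m A ^+ s *m B) i j.
have hE s : moment A (row i C) (col j B) 'X^s = h s.
  by rewrite momentE rmorphXn /= horner_mx_X.
have hrec t : \sum_(l < size b) b`_l * h (t + l)%N = 0.
  rewrite -[RHS](Lb 'X^t) -[b in RHS]coefK poly_def mulr_suml moment_sum.
  by apply: eq_bigr => l _; rewrite -scalerAl -exprD momentZ hE addnC.
have rem := remainder_recurrence (D i j) z hrec.
have {}ha : a = D i j *: b +
    \sum_(l < size b) b`_l *: \sum_(s < l) h s *: 'X^(l - s.+1).
  rewrite {1}ha; congr (_ + _); apply: eq_bigr => l _; congr (_ *: _).
  by apply: eq_bigr => s _; rewrite hE.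
rewrite -ha /= in rem.
have nbz : 0 < normc b.[z].
  rewrite lt_neqAle normc_ge0 andbT eq_sym; apply: contraNneq bz => /eq0_normc -> //.
pose M := \sum_(l < size b) normc b`_l * l%:R.
have M0 : 0 <= M by apply: sumr_ge0 => l _; rewrite mulr_ge0 ?normc_ge0.
have d0 : 0 < eps * normc b.[z] / (M + 1) by rewrite divr_gt0 ?mulr_gt0 // ltr_wpDl.
have [t0 ht] := annihilated_moment_small b0 hb Lb 1 d0.
exists t0 => t tt.
have hs s : normc (h (t + s)%N) <= eps * normc b.[z] / (M + 1).
  rewrite -hE -['X^_]mulr1; apply: ht; exact: leq_trans tt (leq_addr _ _).
have : normc (b.[z] * (z ^+ t * D i j + \sum_(s < t) z ^+ (t - s.+1) * h s - z ^+ t * y))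
    <= eps * normc b.[z] / (M + 1) * M.
  rewrite -normcN.
  have -> : - (b.[z] * (z ^+ t * D i j + \sum_(s < t) z ^+ (t - s.+1) * h s - z ^+ t * y))
     = z ^+ t * a.[z] - b.[z] * (z ^+ t * D i j + \sum_(s < t) z ^+ (t - s.+1) * h s).
    by rewrite ry; field.
  rewrite rem mulr_sumr; apply: le_trans (normc_sum _ _ _) _; apply: ler_sum => l _.
  rewrite normcM mulrCA ler_wpM2l ?normc_ge0 //.
  apply: le_trans (normc_sum _ _ _) _.
  apply: le_trans (_ : \sum_(s < l) eps * normc b.[z] / (M + 1) <= _).
    apply: ler_sum => s _; rewrite normcM.
    by rewrite normcX1 // mul1r.
  by rewrite sumr_const card_ord mulr_natr.
rewrite normcM => H.
rewrite -(ler_pM2l nbz); apply: le_trans H _.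
rewrite -mulrA [eps * _]mulrC -mulrA ler_pM2l // -[leRHS]mulr1 ler_pM2l //.
by rewrite mulrC ler_pdivrMr ?mul1r ?lerDl // ltr_wpDl.
Qed.

(** The Cayley transforms (t + i) / (t - i) of the naturals are pairwise distinct points of the unit
    circle, too many to all lie in [s]. *)
Lemma unimodular_avoid (s : seq K) : exists c : K, normc c = 1 /\ c \notin s.
Proof.
pose f (t : nat) : K := ((t%:R : R) +i* 1)%C / ((t%:R : R) -i* 1)%C.
have nz (t : nat) : ((t%:R : R) -i* 1)%C != 0.
  by rewrite eq_complex /= oppr_eq0 oner_eq0 andbF.
have f1 t : normc (f t) = 1.
  apply: (@complexI R); rewrite -normcE_re /f normrM normfV.
  have -> : `|((t%:R : R) +i* 1)%C| = `|((t%:R : R) -i* 1)%C|.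
    by rewrite !normcE_re /= sqrrN.
  by rewrite divff // normr_eq0.
have finj : injective f.
  move=> t t' /eqP; rewrite /f eqr_div // eq_complex /= => /andP[_ /eqP h].
  apply/eqP; rewrite -(eqr_nat R); apply/eqP; lra.
have [h|h] := boolP (has (fun t => f t \notin s) (iota 0 (size s).+1)).
  by have /hasP[t _ ft] := h; exists (f t).
move/hasPn: h => h.
have : (size (map f (iota 0 (size s).+1)) <= size s)%N.
  apply: uniq_leq_size; first by rewrite map_inj_uniq // iota_uniq.
  by move=> x /mapP[t /h /negbNE ft ->].
by rewrite size_map size_iota ltnn.
Qed.

(** If [c] is not the P-th power of an eigenvalue, then c - X^P is coprime to the characteristic
    polynomial. Bezout and Cayley-Hamilton then give the inverse of c - A^P as a polynomial in A,
    which can be inserted in a moment. *)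
Lemma periodic_resolvent (n : nat) (A : 'M[K]_n.+1) (P : nat) :
  exists (c : K) (q : {poly K}), normc c = 1 /\
    horner_mx A ((c%:P - 'X^P) * q) = 1%:M.
Proof.
have [rs hrs] := closed_field_poly_normal (char_poly A).
have [c [c1 cs]] := unimodular_avoid [seq x ^+ P | x <- rs].
have lc0 : lead_coef (char_poly A) != 0 by rewrite lead_coef_eq0 monic_neq0 ?char_poly_monic.
have cop : coprimep (char_poly A) (c%:P - 'X^P).
  apply/Pdiv.ClosedField.coprimepP => x; rewrite hrs rootZ // root_prod_XsubC => xr.
  rewrite !hornerE subr_eq0; apply: contra cs => /eqP ->.
  exact: map_f.
have /Bezout_coprimepP[[q1 q2] /eqpP[[c1' c2'] /= /andP[c10 c20] e]] := cop.
exists c, ((c1' / c2') *: q2); split=> //.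
have e1 : (c1' / c2') *: (q1 * char_poly A + q2 * (c%:P - 'X^P)) = 1.
  by rewrite mulrC -scalerA e scalerA mulVf // scale1r.
have -> : (c%:P - 'X^P) * ((c1' / c2') *: q2) = 1 - ((c1' / c2') *: q1) * char_poly A.
  by rewrite -e1 -!mul_polyC; ring.
by rewrite rmorphB rmorph1 rmorphM /= Cayley_Hamilton mulr0 subr0.
Qed.

Lemma finite_threshold (T : finType) (Q : T -> nat -> Prop) :
  (forall x, exists l0 : nat, forall l : nat, (l0 <= l)%N -> Q x l) ->
  exists l0 : nat, forall l : nat, (l0 <= l)%N -> forall x, Q x l.
Proof.
move/choice => [f hf]; exists (\max_x f x)%N => l ll x.
by apply: hf; apply: leq_trans ll; exact: leq_bigmax.
Qed.

(** The order of quantifiers is the point: [l0] comes from the tail of the impulse response alone,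
    before the period and [c] are chosen. The period can thus itself depend on [l0]. *)
Lemma periodic_resolvent_bound (n m p : nat) (A : 'M[K]_n) (B : 'M[K]_(n, m))
    (C : 'M[K]_(p, n)) (D : 'M[K]_(p, m)) (eps : R) :
  stable (transfer A B C D) -> 0 < eps ->
  exists l0 : nat, forall P : nat, (0 < P)%N -> exists (c : K) (N : 'M[K]_n),
  [/\ normc c = 1, (c%:M - A ^+ P) *m N = 1%:M &
    forall s t : nat, (l0 <= s + t)%N -> forall i j,
      normc ((C *m A ^+ s *m N *m A ^+ t *m B) i j) <= eps].
Proof.
case: n A B C => [|n] A B C st eps0.
  exists 0%N => P _; exists 1, 0; split; first exact: normc1.
    by rewrite [LHS]thinmx0 [RHS]thinmx0.
  by move=> s t _ i j; rewrite mulmx0 !mul0mx mxE normc0 ltW.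
have [l0 hl0] : exists l0 : nat, forall l : nat, (l0 <= l)%N -> forall ij : 'I_p * 'I_m,
    forall (P : nat) (c : K) (q : {poly K}), (0 < P)%N -> normc c = 1 ->
    horner_mx A ((c%:P - 'X^P) * q) = 1%:M ->
    normc (moment A (row ij.1 C) (col ij.2 B) ('X^l * q)) <= eps.
  apply: finite_threshold => -[i j] /=.
  have [a [b [b0 e hb Lb ha]]] := stable_moments i j st.
  have [l0 tail] := annihilated_moment_tail b0 hb Lb 1 eps0.
  exists l0 => l ll P c q P0 c1 hq.
  apply: (periodic_moment_small b0 hb Lb tail P0 c1 _ ll) => f.
  by rewrite /moment rmorphM /= hq mul1r.
exists l0 => P P0; have [c [q [c1 hq]]] := periodic_resolvent A P.
exists c, (horner_mx A q); split=> //.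
  rewrite -hq rmorphM rmorphB /= rmorphXn /= horner_mx_X horner_mx_C //.
move=> s t st0 i j; have := hl0 _ st0 (i, j) P c q P0 c1 hq.
rewrite momentE /=; congr (normc (_ i j) <= _); congr (_ *m _).
rewrite -!mulmxA; congr (_ *m _).
(* Being a polynomial in A, the inverse commutes with powers of A, so only the total exponent s + t
   matters. *)
by rewrite exprD -mulrA [_ * q]mulrC rmorphM rmorphM /= !rmorphXn /= horner_mx_X.
Qed.
End Transfer.

(** * Power of signals and the rounding bound *)

Section Power.
Variable R : realType.
Local Notation K := R[i].

Lemma cvg_sum (I : Type) (r : seq I) (f : I -> nat -> R) (l : I -> R) :
  (forall i, f i t @[t --> \oo] --> l i) ->
  \sum_(i <- r) f i t @[t --> \oo] --> \sum_(i <- r) l i.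
Proof. by move=> h; apply: cvg_big => //; exact: add_continuous. Qed.

Lemma cvg_sqr (f : nat -> R) (l : R) :
  f t @[t --> \oo] --> l -> f t ^+ 2 @[t --> \oo] --> l ^+ 2.
Proof. by move=> h; exact: (cvg_comp _ _ h (@exprn_continuous R 2 l)). Qed.

Lemma normc_dist (a b : K) : `|normc b - normc a| <= normc (a - b).
Proof.
have ha := le_normcD (a - b) b; have hb := le_normcD (b - a) a.
rewrite subrK in ha; rewrite subrK -opprB normcN in hb.
by rewrite ler_norml; apply/andP; split; lra.
Qed.

Definition sqnorm d (x : 'cV[K]_d) : R := \sum_i normc (x i 0) ^+ 2.

Lemma sqnormE d (x : 'cV[K]_d) : ((sqnorm x)%:C)%C = (x ^t* *m x) 0 0.
Proof.
rewrite mxE rmorph_sum /=; apply: eq_bigr => i _.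
by rewrite !mxE -normCKC normcE_re -rmorphXn.
Qed.

Lemma sqnorm_ge0 d (x : 'cV[K]_d) : 0 <= sqnorm x.
Proof. by apply: sumr_ge0 => i _; rewrite exprn_ge0 ?normc_ge0. Qed.

Lemma sqnormZ d (c : K) (x : 'cV[K]_d) : sqnorm (c *: x) = normc c ^+ 2 * sqnorm x.
Proof.
by rewrite mulr_sumr; apply: eq_bigr => i _; rewrite mxE normcM exprMn.
Qed.

Lemma avg_powerE d (x : nat -> 'cV[K]_d) N :
  avg_power x N = N%:R^-1 * \sum_(j < N) sqnorm (x j).
Proof.
by rewrite /avg_power; congr (_ * _); apply: eq_bigr => j _; rewrite -sqnormE.
Qed.

Lemma avg_power_ge0 d (x : nat -> 'cV[K]_d) N : 0 <= avg_power x N.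
Proof.
rewrite avg_powerE mulr_ge0 ?invr_ge0 //.
by apply: sumr_ge0 => j _; exact: sqnorm_ge0.
Qed.

Lemma sqnorm_channel d (w : nat -> 'cV[K]_d) i j :
  sqnorm (channel w i j) = normc (w j i 0) ^+ 2.
Proof. by rewrite /sqnorm big_ord1 mxE. Qed.

Lemma avg_power_channels d (w : nat -> 'cV[K]_d) N :
  avg_power w N = \sum_i avg_power (channel w i) N.
Proof.
rewrite avg_powerE exchange_big mulr_sumr; apply: eq_bigr => i _.
by rewrite avg_powerE; congr (_ * _); apply: eq_bigr => j _; rewrite sqnorm_channel.
Qed.

Lemma avg_power_cvg d (x : nat -> 'cV[K]_d) (l : R) :
  sqnorm (x j) @[j --> \oo] --> l -> avg_power x N @[N --> \oo] --> l.
Proof.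
(* [arithmetic_mean] at index N averages N + 1 terms, hence the shift. *)
move=> /cesaro h; rewrite -(cvg_shiftS (avg_power x)); apply: cvg_trans h.
apply: near_eq_cvg; near=> N.
by rewrite /arithmetic_mean /= avg_powerE /series /= big_mkord.
Unshelve. all: by end_near. Qed.

Lemma pnorm_cvg d (x : nat -> 'cV[K]_d) (l : R) :
  avg_power x N @[N --> \oo] --> l -> pnorm x = Num.sqrt l.
Proof. by move=> h; rewrite /pnorm (cvg_lim _ h). Qed.

Lemma has_power_cvg d (x : nat -> 'cV[K]_d) :
  has_power x -> avg_power x N @[N --> \oo] --> pnorm x ^+ 2.
Proof.
move=> h; rewrite /pnorm sqr_sqrtr //; apply: limr_ge => //.
by apply: nearW => N; exact: avg_power_ge0.
Qed.

End Power.

Section Rounding.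
Variable R : realType.
Local Notation K := R[i].

Lemma state_formula (n m : nat) (A : 'M[K]_n) (B : 'M[K]_(n, m))
    (w : nat -> 'cV[K]_m) (x : nat -> 'cV[K]_n) :
  (forall j, x j.+1 = A *m x j + B *m w j) ->
  forall j, x j = A ^+ j *m x 0%N + \sum_(s < j) A ^+ (j - s.+1) *m B *m w s.
Proof.
move=> hx; elim=> [|j IH]; first by rewrite big_ord0 addr0 expr0 mul1mx.
rewrite hx {1}IH mulmxDr mulmxA -[A *m _]/(A * _) -exprS -addrA; congr (_ + _).
rewrite big_ord_recr /= subnn expr0 mul1mx; congr (_ + _).
rewrite mulmx_sumr; apply: eq_bigr => s _.
by rewrite !mulmxA -[A *m _]/(A * _) -exprS subnSK.
Qed.

(** Each output entry differs from z^t (G u)_i by a combination of the errors of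
    [frequency_response], and the factor z^t disappears from the modulus. The state itself may be
    unbounded; only the output is estimated. *)
Lemma sinusoid_response (n m p : nat) (A : 'M[K]_n) (B : 'M[K]_(n, m))
    (C : 'M[K]_(p, n)) (D : 'M[K]_(p, m)) (z : K) (G : 'M[K]_(p, m))
    (u : 'cV[K]_m) (x : nat -> 'cV[K]_n) :
  stable (transfer A B C D) -> normc z = 1 ->
  (forall i j, rat_value (transfer A B C D i j) z (G i j)) ->
  x 0%N = 0 -> (forall j, x j.+1 = A *m x j + B *m (z ^+ j *: u)) ->
  sqnorm (C *m x j + D *m (z ^+ j *: u)) @[j --> \oo] --> sqnorm (G *m u).
Proof.
move=> st z1 hG x0 hx.
apply: cvg_sum => i; apply: cvg_sqr.
pose err l (t : nat) : K :=
  z ^+ t * D i l + \sum_(s < t) z ^+ (t - s.+1) * (C *m A ^+ s *m B) i l - z ^+ t * G i l.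
have zt t : normc (z ^+ t) = 1 by exact: normcX1.
have yE (t : nat) : (C *m x t + D *m (z ^+ t *: u)) i 0 - z ^+ t * (G *m u) i 0 =
    \sum_l err l t * u l 0.
  rewrite (state_formula hx) x0 mulmx0 add0r.
  have -> : \sum_(s < t) A ^+ (t - s.+1) *m B *m (z ^+ s *: u)
      = \sum_(s < t) z ^+ (t - s.+1) *: (A ^+ s *m B *m u).
    rewrite (reindex_inj rev_ord_inj) /=; apply: eq_bigr => s _.
    by rewrite subnSK // subKn ?(ltnW (ltn_ord s)) // -scalemxAr.
  have -> : C *m (\sum_(s < t) z ^+ (t - s.+1) *: (A ^+ s *m B *m u)) + D *m (z ^+ t *: u)
      = (\sum_(s < t) z ^+ (t - s.+1) *: (C *m A ^+ s *m B) + z ^+ t *: D) *m u.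
    rewrite mulmxDl mulmx_suml mulmx_sumr -scalemxAr scalemxAl; congr (_ + _).
    by apply: eq_bigr => s _; rewrite -scalemxAr -scalemxAl !mulmxA.
  rewrite !mxE mulr_sumr -sumrB; apply: eq_bigr => l _.
  rewrite !mxE summxE /err.
  rewrite [X in X * u l 0 - _](_ : _ = z ^+ t * D i l +
     \sum_(s < t) z ^+ (t - s.+1) * (C *m A ^+ s *m B) i l); first by ring.
  by rewrite addrC; congr (_ + _); apply: eq_bigr => s _; rewrite [LHS]mxE.
apply/cvgrPdist_le => eps eps0.
pose M : R := \sum_l normc (u l 0).
have M0 : 0 <= M by apply: sumr_ge0 => l _; exact: normc_ge0.
have d0 : 0 < eps / (M + 1) by rewrite divr_gt0 // ltr_wpDl.
have [t0 ht] := finite_threshold (fun l => frequency_response st z1 (hG i l) d0).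
exists t0 => // t /= tt.
apply: le_trans (_ : normc ((C *m x t + D *m (z ^+ t *: u)) i 0 - z ^+ t * (G *m u) i 0) <= _).
  rewrite -[normc ((G *m u) i 0)]mul1r -(zt t) -normcM; exact: normc_dist.
rewrite yE; apply: le_trans (normc_sum _ _ _) _.
apply: le_trans (_ : \sum_l eps / (M + 1) * normc (u l 0) <= _).
  by apply: ler_sum => l _; rewrite normcM ler_wpM2r ?normc_ge0 //; exact: ht.
rewrite -mulr_sumr -/M -mulrA ger_pMr // mulrC ler_pdivrMr ?mul1r ?lerDl //.
by rewrite ltr_wpDl.
Qed.

Lemma mulmx_selection (q m k : nat) (M : 'M[K]_(q, m)) (idx : 'I_k -> 'I_m) i l :
  (M *m selection R idx) i l = M i (idx l).
Proof.
rewrite mxE (bigD1 (idx l)) //= !mxE eqxx mulr1 big1 ?addr0 // => j jl.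
by rewrite !mxE (negPf jl) mulr0.
Qed.

Lemma transfer_selection (n m p k : nat) (A : 'M[K]_n) (B : 'M[K]_(n, m))
    (C : 'M[K]_(p, n)) (D : 'M[K]_(p, m)) (idx : 'I_k -> 'I_m) i l :
  transfer A (B *m selection R idx) C (D *m selection R idx) i l =
  transfer A B C D i (idx l).
Proof.
rewrite /transfer mxE [RHS]mxE; congr (_ + _); last first.
  by rewrite mxE [RHS]mxE mulmx_selection.
rewrite mxE [RHS]mxE; apply: eq_bigr => q _; congr (_ * _).
by rewrite mxE [RHS]mxE mulmx_selection.
Qed.

End Rounding.

Section RoundingBound.
Variable R : realType.
Local Notation K := R[i].

Fixpoint trajectory n m (A : 'M[K]_n) (B : 'M[K]_(n, m)) (w : nat -> 'cV[K]_m)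
    (x0 : 'cV[K]_n) (j : nat) : 'cV[K]_n :=
  if j is j'.+1 then A *m trajectory A B w x0 j' + B *m w j' else x0.

Lemma conjT_mul m n p (M : 'M[K]_(m, n)) (N : 'M[K]_(n, p)) :
  (M *m N) ^t* = N ^t* *m M ^t*.
Proof. by rewrite trmx_mul map_mxM. Qed.

Lemma sqnorm_gt0 d (x : 'cV[K]_d) : x != 0 -> 0 < sqnorm x.
Proof.
move=> x0; rewrite lt_neqAle sqnorm_ge0 andbT eq_sym; apply: contraNneq x0 => /eqP.
rewrite psumr_eq0 => [/allP h|i _]; last by rewrite exprn_ge0 ?normc_ge0.
apply/eqP/matrixP => i j; rewrite ord1 mxE.
have := h i (mem_index_enum i); rewrite sqrf_eq0 => /eqP; exact: eq0_normc.
Qed.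

Lemma singular_vector p m (G : 'M[K]_(p, m)) (s : R) : singular_value G s ->
  exists u : 'cV[K]_m, sqnorm u = 1 /\ sqnorm (G *m u) = s ^+ 2.
Proof.
move=> [s0 /eigenvalueP[v hv v0]].
(* [eigenvalue] provides a row eigenvector [v]. For its conjugate transpose [u0], the squared norm
   of G u0 is v (G^* G) u0, that is s^2 times that of [u0]. *)
pose u0 := v ^t*.
have u00 : u0 != 0.
  by apply: contraNneq v0 => h; rewrite -[v]trmxCK -/u0 h trmx0 map_mx0.
have hG : sqnorm (G *m u0) = s ^+ 2 * sqnorm u0.
  apply: (@complexI R); rewrite rmorphM /= !sqnormE conjT_mul mulmxA.
  have -> : u0 ^t* = v by exact: trmxCK.
  by rewrite -[v *m _ *m _]mulmxA hv -scalemxAl mxE.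
have su0 := sqnorm_gt0 u00.
pose c : K := (((Num.sqrt (sqnorm u0))^-1)%:C)%C.
have hc : normc c ^+ 2 = (sqnorm u0)^-1.
  have -> : normc c = (Num.sqrt (sqnorm u0))^-1.
    apply: (@complexI R); rewrite -normcE_re ger0_norm // ler0c invr_ge0 sqrtr_ge0 //.
  by rewrite exprVn sqr_sqrtr // ltW.
exists (c *: u0); rewrite -scalemxAr !sqnormZ hc hG mulVf ?gt_eqF //; split=> //.
by rewrite mulrCA mulVf ?gt_eqF // mulr1.
Qed.

Lemma mu_sparse_ge n m p (A : 'M[K]_n) (B : 'M[K]_(n, m))
    (C : 'M[K]_(p, n)) (D : 'M[K]_(p, m)) (k : nat) w x :
  sparse_feasible A B C D k w x ->
  ((pnorm (output C D w x))%:E <= mu_sparse A B C D k)%E.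
Proof.
move=> h; set S := [set v | exists w x, sparse_feasible A B C D k w x /\
  v = (pnorm (output C D w x) ^+ 2)%:E].
have hS : ((pnorm (output C D w x) ^+ 2)%:E <= ereal_sup S)%E.
  by apply: ereal_sup_ubound; exists w, x.
have := hS; rewrite -lee_sqrt; last by apply: le_trans hS; rewrite lee_fin sqr_ge0.
by rewrite /= sqrtr_sqr ger0_norm // sqrtr_ge0.
Qed.

(** The input z^j E u has constant energy in each channel and is zero off the range of [idx], so its
    powers exist and at most k channels are active; the output power comes from the steady state. *)
Lemma mu_sparse_ge_response n m p k (A : 'M[K]_n) (B : 'M[K]_(n, m))
    (C : 'M[K]_(p, n)) (D : 'M[K]_(p, m)) (idx : 'I_k -> 'I_m) (z : K)
    (G : 'M[K]_(p, k)) (u : 'cV[K]_k) :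
  stable (transfer A B C D) -> injective idx -> normc z = 1 ->
  (forall i l, rat_value
     (transfer A (B *m selection R idx) C (D *m selection R idx) i l) z (G i l)) ->
  sqnorm u = 1 ->
  ((Num.sqrt (sqnorm (G *m u)))%:E <= mu_sparse A B C D k)%E.
Proof.
move=> st idxI z1 hG u1.
pose E : 'M[K]_(m, k) := selection R idx.
pose w j : 'cV[K]_m := z ^+ j *: (E *m u).
pose x := trajectory A B w 0.
have zt t : normc (z ^+ t) = 1 by exact: normcX1.
pose I := [set idx l | l in 'I_k]%SET.
have Eu i : i \notin I -> (E *m u) i 0 = 0.
  move=> hi; rewrite mxE big1 // => l _; rewrite mxE.
  by case: eqP => [e|_]; [case/negP: hi; rewrite e imset_f | rewrite mul0r].
have Eul l : (E *m u) (idx l) 0 = u l 0.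
  rewrite mxE (bigD1 l) //= mxE eqxx mul1r big1 ?addr0 // => l' l'l.
  by rewrite mxE (inj_eq idxI) eq_sym (negPf l'l) mul0r.
have sEu : sqnorm (E *m u) = 1.
  rewrite -u1 /sqnorm (bigID (mem (I))) /= [X in _ + X]big1 => [|i hi]; last first.
    by rewrite Eu // normc0 expr0n.
  rewrite addr0 big_imset /=; last by move=> ? ? _ _; exact: idxI.
  by apply: eq_bigr => l _; rewrite Eul.
have wP : avg_power w N @[N --> \oo] --> (1 : R).
  apply: avg_power_cvg; apply: cvg_near_cst; apply: nearW => j.
  by rewrite sqnormZ zt expr1n mul1r.
have wc i : avg_power (channel w i) N @[N --> \oo] --> normc ((E *m u) i 0) ^+ 2.
  apply: avg_power_cvg; apply: cvg_near_cst; apply: nearW => j.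
  by rewrite sqnorm_channel mxE normcM zt mul1r.
have yP : avg_power (output C D w x) N @[N --> \oo] --> sqnorm (G *m u).
  apply: avg_power_cvg.
  have st' : stable (transfer A (B *m E) C (D *m E)).
    by move=> i l; rewrite transfer_selection; exact: st.
  have := @sinusoid_response R n k p A (B *m E) C (D *m E) z G u x st' z1 hG erefl.
  move=> H; rewrite /output /w.
  under eq_fun do rewrite scalemxAr mulmxA.
  by apply: H => j; rewrite /x /= -/x /w scalemxAr mulmxA.
rewrite -(pnorm_cvg yP); apply: mu_sparse_ge; split.
  split; first by apply/cvg_ex; exists 1.
    by move=> i; apply/cvg_ex; eexists; exact: wc.
  by apply/cvg_ex; eexists; exact: yP.
split=> //; first by rewrite (pnorm_cvg wP) sqrtr1 expr1n.
rewrite /Card; apply: leq_trans (_ : #|I| <= k)%N; last first.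
  by rewrite (leq_trans (leq_imset_card _ _)) // cardT size_enum_ord.
apply/subset_leq_card/fintype.subsetP => i; rewrite inE (pnorm_cvg (wc i)).
by apply: contraTT => /Eu ->; rewrite normc0 expr0n sqrtr0 ltxx.
Qed.

Lemma mu_round_le n m p k (A : 'M[K]_n) (B : 'M[K]_(n, m))
    (C : 'M[K]_(p, n)) (D : 'M[K]_(p, m)) (idx : 'I_k -> 'I_m) :
  stable (transfer A B C D) -> injective idx ->
  (mu_round A B C D idx <= mu_sparse A B C D k)%E.
Proof.
move=> st idxI; apply: ub_ereal_sup => _ [z [G [z1 hG ->]]].
have {}z1 : normc z = 1 by apply: (@complexI R); rewrite -normcE_re z1.
have h s : singular_value G s -> (s%:E <= mu_sparse A B C D k)%E.
  move=> sv; have [u [u1 Gu]] := singular_vector sv.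
  have := mu_sparse_ge_response st idxI z1 hG u1.
  by rewrite Gu sqrtr_sqr ger0_norm //; case: sv.
have : (0 <= mu_sparse A B C D k)%E by exact: sqrte_ge0.
case: (mu_sparse A B C D k) h => [r||] h // r0; last by rewrite leey.
rewrite lee_fin /largest_singular_value.
(* On an empty set [sup] takes the default value 0, covered by the nonnegativity of [mu_sparse]. *)
have [->|/set0P S0] := eqVneq [set s | singular_value G s] set0.
  by rewrite sup0.
by apply: ge_sup => // s /h.
Qed.

End RoundingBound.

(** * Gram matrices over a period and the semidefinite bound *)

Lemma cauchy_schwarz (R : rcfType) (I : finType) (P : pred I) (f g : I -> R) :
  \sum_(i | P i) f i * g i <=
  Num.sqrt (\sum_(i | P i) f i ^+ 2) * Num.sqrt (\sum_(i | P i) g i ^+ 2).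
Proof.
set F := \sum_(i | P i) f i ^+ 2; set G := \sum_(i | P i) g i ^+ 2.
have F0 : 0 <= F by apply: sumr_ge0 => i _; exact: sqr_ge0.
have G0 : 0 <= G by apply: sumr_ge0 => i _; exact: sqr_ge0.
have vanish (h : I -> R) : \sum_(i | P i) h i ^+ 2 = 0 -> forall i, P i -> h i = 0.
  move/eqP; rewrite psumr_eq0 => [/allP H i Pi|i _]; last exact: sqr_ge0.
  by have := H i (mem_index_enum i); rewrite Pi sqrf_eq0 => /eqP.
have [F00|F1] := eqVneq F 0.
  rewrite big1 ?mulr_ge0 ?sqrtr_ge0 // => i Pi.
  by rewrite (vanish f F00 i Pi) mul0r.
have [G00|G1] := eqVneq G 0.
  rewrite big1 ?mulr_ge0 ?sqrtr_ge0 // => i Pi.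
  by rewrite (vanish g G00 i Pi) mulr0.
set s := Num.sqrt F; set t := Num.sqrt G.
have s0 : 0 < s by rewrite sqrtr_gt0 lt_neqAle eq_sym F1.
have t0 : 0 < t by rewrite sqrtr_gt0 lt_neqAle eq_sym G1.
(* Expanded with s^2 = F and t^2 = G, this reads 2 S s t <= 2 (s t)^2, to be divided by the positive
   s t. *)
have : 0 <= \sum_(i | P i) (f i * t - g i * s) ^+ 2 by apply: sumr_ge0 => i _; exact: sqr_ge0.
have -> : \sum_(i | P i) (f i * t - g i * s) ^+ 2 =
    F * t ^+ 2 + G * s ^+ 2 - (\sum_(i | P i) f i * g i) * (2 * s * t).
  rewrite !mulr_suml -sumrN -!big_split; apply: eq_bigr => i _ /=; ring.
have -> : t ^+ 2 = G by rewrite sqr_sqrtr.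
have -> : s ^+ 2 = F by rewrite sqr_sqrtr.
have -> : F = s * s by rewrite -expr2 sqr_sqrtr.
have -> : G = t * t by rewrite -expr2 sqr_sqrtr.
have st : 0 < s * t by rewrite mulr_gt0.
set S := \sum_(i | _) _ => h.
rewrite -(ler_pM2r st); nra.
Qed.

Section Gram.
Variable R : realType.
Local Notation K := R[i].

(** Empirical cross-correlation over [P] steps. The weight is kept free because the averages are
    later normalized by the length of the given piece of signal, not by the longer period. *)
Definition gram d e (a : R) (P : nat) (f : nat -> 'cV[K]_d) (g : nat -> 'cV[K]_e) :
    'M[K]_(d, e) :=
  (a%:C)%C *: \sum_(j < P) f j *m (g j) ^t*.

Lemma gram_conjT d e a P (f : nat -> 'cV[K]_d) (g : nat -> 'cV[K]_e) :
  (gram a P f g) ^t* = gram a P g f.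
Proof.
have ca : Num.conj ((a%:C)%C : K) = (a%:C)%C.
  by apply: conj_Creal; apply/complex_realP; exists a.
apply/matrixP => i j; rewrite !mxE rmorphM /= !summxE rmorph_sum ca.
congr (_ * _); apply: eq_bigr => s _.
by rewrite !mxE !big_ord1 !mxE rmorphM /= conjCK mulrC.
Qed.

Lemma mulmx_gram d e d' e' a P (f : nat -> 'cV[K]_d) (g : nat -> 'cV[K]_e)
    (M : 'M[K]_(d', d)) (N : 'M[K]_(e', e)) :
  M *m gram a P f g *m N ^t* = gram a P (fun j => M *m f j) (fun j => N *m g j).
Proof.
rewrite /gram -scalemxAr -scalemxAl mulmx_sumr mulmx_suml; congr (_ *: _).
by apply: eq_bigr => j _; rewrite conjT_mul !mulmxA.
Qed.

Lemma gram_block n m a P (x : nat -> 'cV[K]_n) (w : nat -> 'cV[K]_m) :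
  sdp_block (gram a P x x) (gram a P x w) (gram a P w w) =
  gram a P (fun j => col_mx (x j) (w j)) (fun j => col_mx (x j) (w j)).
Proof.
rewrite /sdp_block gram_conjT /gram -scale_block_mx; congr (_ *: _).
elim: P => [|P IH]; first by rewrite !big_ord0 block_mx0.
by rewrite !big_ord_recr /= -IH tr_col_mx map_row_mx mul_col_row add_block_mx.
Qed.

Lemma mxtrace_gram d a P (f : nat -> 'cV[K]_d) :
  \tr (gram a P f f) = ((a * \sum_(j < P) sqnorm (f j))%:C)%C.
Proof.
rewrite /gram mxtraceZ rmorphM /=; congr (_ * _).
rewrite raddf_sum rmorph_sum /=; apply: eq_bigr => j _.
by rewrite mxtrace_mulC sqnormE /mxtrace big_ord1.
Qed.

Lemma psd_gram d a P (f : nat -> 'cV[K]_d) : 0 <= a -> psd (gram a P f f).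
Proof.
move=> a0; split; first exact: gram_conjT.
move=> v; have := mulmx_gram a P f f (v ^t*) (v ^t*); rewrite trmxCK => ->.
have := mxtrace_gram a P (fun j => v ^t* *m f j); rewrite /mxtrace big_ord1 => ->.
by rewrite ler0c mulr_ge0 // sumr_ge0 // => j _; exact: sqnorm_ge0.
Qed.

Section Feasible.
Variables (n m p : nat) (A : 'M[K]_n) (B : 'M[K]_(n, m)).
Variables (C : 'M[K]_(p, n)) (D : 'M[K]_(p, m)).
Variables (a : R) (P : nat) (x : nat -> 'cV[K]_n) (w : nat -> 'cV[K]_m).

Lemma sdp_objective_gram :
  sdp_objective C D (gram a P x x) (gram a P x w) (gram a P w w) =
  a * \sum_(j < P) sqnorm (output C D w x j).
Proof.
rewrite /sdp_objective gram_block.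
have -> : block_mx (C ^t* *m C) (C ^t* *m D) (D ^t* *m C) (D ^t* *m D) =
    (row_mx C D) ^t* *m row_mx C D.
  by rewrite tr_row_mx map_col_mx mul_col_row.
rewrite -mulmxA mxtrace_mulC mulmx_gram mxtrace_gram /=.
by congr (_ * _); apply: eq_bigr => j _; rewrite mul_row_col.
Qed.

(* A factor of modulus one does not change the Gram matrix, so the closing
   condition on [x P] turns one time step into the Lyapunov equation. *)
Lemma gram_lyapunov (c : K) : normc c = 1 ->
  (forall j, x j.+1 = A *m x j + B *m w j) -> x P = c *: x 0%N ->
  gram a P x x = row_mx A B *m
    sdp_block (gram a P x x) (gram a P x w) (gram a P w w) *m col_mx (A ^t*) (B ^t*).
Proof.
move=> c1 hx hP; rewrite gram_block.
have -> : col_mx (A ^t*) (B ^t*) = (row_mx A B) ^t* by rewrite tr_row_mx map_col_mx.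
rewrite mulmx_gram /gram; congr (_ *: _).
transitivity (\sum_(j < P) x j.+1 *m (x j.+1) ^t*); last first.
  by apply: eq_bigr => j _; rewrite mul_row_col hx.
(* With this term added, both sides are the sum over times 0 to P, split off at its last or at its
   first term. *)
apply: (@addIr _ (x 0%N *m (x 0%N) ^t*)).
have xP : x P *m (x P) ^t* = x 0%N *m (x 0%N) ^t*.
  rewrite hP linearZ /= map_mxZ /= -scalemxAl -scalemxAr scalerA.
  by rewrite -normCK normcE_re c1 expr1n scale1r.
rewrite -{1}xP -[LHS](@big_ord_recr _ _ _ P (fun j => x j *m (x j) ^t*)).
by rewrite big_ord_recl /= addrC.
Qed.

Lemma gram_entry_le i l : 0 <= a ->
  normc (gram a P w w i l) <=
  Num.sqrt (a * \sum_(j < P) normc (w j i 0) ^+ 2) *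
  Num.sqrt (a * \sum_(j < P) normc (w j l 0) ^+ 2).
Proof.
move=> a0.
have ca : normc ((a%:C)%C : K) = a.
  by apply: (@complexI R); rewrite -normcE_re ger0_norm // ler0c.
rewrite /gram mxE normcM ca !sqrtrM // mulrACA -expr2 sqr_sqrtr // ler_wpM2l //.
apply: le_trans (cauchy_schwarz _ _ _); rewrite summxE.
apply: le_trans (normc_sum _ _ _) _; apply: ler_sum => j _.
rewrite mxE big_ord1 !mxE normcM.
have -> // : normc (Num.conj (w j l 0)) = normc (w j l 0).
by apply: (@complexI R); rewrite -!normcE_re norm_conjC.
Qed.

(** By Cauchy-Schwarz |W_il| <= sqrt(W_ii) sqrt(W_ll), so the entrywise l1 norm of W is at most the
    squared sum of the channel amplitudes. That is the form in which sparsity is controlled. *)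
Lemma gram_feasible (k : nat) (c : K) : 0 <= a -> normc c = 1 ->
  (forall j, x j.+1 = A *m x j + B *m w j) -> x P = c *: x 0%N ->
  a * \sum_(j < P) sqnorm (w j) <= 1 ->
  (\sum_i Num.sqrt (a * \sum_(j < P) normc (w j i 0) ^+ 2)) ^+ 2 <= k%:R ->
  sdp_feasible A B k (gram a P x x) (gram a P x w) (gram a P w w).
Proof.
move=> a0 c1 hx hP tr1 hk; split.
- exact: gram_lyapunov c1 hx hP.
- by rewrite mxtrace_gram -(rmorph1 (real_complex R)) lecR.
- have -> : ((ones R m)^T *m absmx (gram a P w w) *m ones R m) 0 0 =
    ((\sum_l \sum_i normc (gram a P w w i l))%:C)%C.
    rewrite mxE rmorph_sum; apply: eq_bigr => l _; rewrite !mxE mulr1 rmorph_sum.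
    by apply: eq_bigr => i _; rewrite !mxE mul1r.
  rewrite -(rmorph_nat (real_complex R)) lecR; apply: le_trans hk.
  rewrite expr2 big_distrl /= exchange_big; apply: ler_sum => i _.
  rewrite big_distrr /=; apply: ler_sum => l _; exact: gram_entry_le.
- by rewrite gram_block; exact: psd_gram.
Qed.

End Feasible.
End Gram.

(** * Periodization of a feasible signal and the upper bound *)

Section Relaxation.
Variable R : realType.
Local Notation K := R[i].

(** Entrywise |y + e|^2 >= |y|^2 - 2 |y| |e|: by the triangle inequality if |e| <= |y|, and because
    the right side is nonpositive otherwise. *)
Lemma sqnorm_perturb d (y e : 'cV[K]_d) (eps : R) :
  (forall i, normc (e i 0) <= eps) ->
  sqnorm y - 2 * eps * \sum_i normc (y i 0) <= sqnorm (y + e).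
Proof.
move=> he; rewrite /sqnorm mulr_sumr -sumrB; apply: ler_sum => i _; rewrite mxE.
have h := le_normcD (y i 0 + e i 0) (- e i 0); rewrite addrK normcN in h.
have := normc_ge0 (y i 0); have := normc_ge0 (e i 0).
have := normc_ge0 (y i 0 + e i 0); have := he i.
set p := normc (y i 0) in h *; set q := normc (_ + _) in h *; set r := normc (e i 0) in h *.
move=> re q0 r0 p0.
have h1 : p * r <= p * eps by rewrite ler_wpM2l.
suff : p ^+ 2 - 2 * (p * r) <= q ^+ 2 by lra.
have [rp|pr] := lerP r p; last nra.
have h2 : (p - r) ^+ 2 <= q ^+ 2 by rewrite ler_sqr ?nnegrE ?subr_ge0 // lerBlDr.
by have := sqr_ge0 r; rewrite sqrrB in h2; lra.
Qed.

Section Periodization.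
Variables (n m p : nat) (A : 'M[K]_n) (B : 'M[K]_(n, m)).
Variables (C : 'M[K]_(p, n)) (D : 'M[K]_(p, m)).
Variables (w : nat -> 'cV[K]_m) (N M : nat).

Definition truncated (j : nat) : 'cV[K]_m := if (j < N)%N then w j else 0.

Lemma sum_truncated (V : zmodType) (F : nat -> 'cV[K]_m -> V) :
  (forall j, F j 0 = 0) ->
  \sum_(j < N + M) F j (truncated j) = \sum_(j < N) F j (w j).
Proof.
move=> F0; rewrite big_split_ord /= [X in _ + X]big1 ?addr0 => [|j _].
  by apply: eq_bigr => j _; rewrite /truncated ltn_ord.
by rewrite /truncated ltnNge leq_addr /= F0.
Qed.

Variables (c : K) (Z : 'M[K]_n).
Hypothesis hZ : (c%:M - A ^+ (N + M)) *m Z = 1%:M.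

(** The solution of c x_0 = A^(N+M) x_0 + (forced response at time N + M), [Z] being the inverse of
    c - A^(N+M). *)
Definition periodic_start : 'cV[K]_n :=
  Z *m \sum_(s < N) A ^+ (N + M - s.+1) *m B *m w s.

Local Notation x' := (trajectory A B truncated periodic_start).

Lemma periodic_closure : x' (N + M) = c *: periodic_start.
Proof.
rewrite (@state_formula R n m A B truncated x') //.
rewrite (@sum_truncated _ (fun s v => A ^+ (N + M - s.+1) *m B *m v)) => [|j]; last first.
  by rewrite mulmx0.
have -> : \sum_(s < N) A ^+ (N + M - s.+1) *m B *m w s =
    (c%:M - A ^+ (N + M)) *m periodic_start.
  by rewrite /periodic_start mulmxA hZ mul1mx.
by rewrite mulmxBl mul_scalar_mx addrC subrK.
Qed.

Variable x : nat -> 'cV[K]_n.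
Hypothesis hx : forall j, x j.+1 = A *m x j + B *m w j.
Hypothesis x0 : x 0%N = 0.

Lemma periodic_output (j : nat) : (j < N)%N ->
  output C D truncated x' j = output C D w x j + C *m A ^+ j *m periodic_start.
Proof.
move=> jN; rewrite /output (@state_formula R n m A B truncated x') //.
rewrite (state_formula hx) x0 mulmx0 add0r /truncated jN.
have -> : \sum_(s < j) A ^+ (j - s.+1) *m B *m (if (s < N)%N then w s else 0) =
    \sum_(s < j) A ^+ (j - s.+1) *m B *m w s.
  by apply: eq_bigr => s _; rewrite (ltn_trans (ltn_ord s) jN).
by rewrite mulmxDr mulmxA /= -addrA addrC.
Qed.

Lemma periodic_start_small (eps : R) (j : nat) i :
  (forall s t : nat, (M <= s + t)%N -> forall i l,
      normc ((C *m A ^+ s *m Z *m A ^+ t *m B) i l) <= eps) ->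
  normc ((C *m A ^+ j *m periodic_start) i 0) <=
  eps * \sum_(s < N) \sum_l normc (w s l 0).
Proof.
move=> h; rewrite /periodic_start mulmxA mulmx_sumr summxE mulr_sumr.
apply: le_trans (normc_sum _ _ _) _; apply: ler_sum => s _.
rewrite mulr_sumr !mulmxA mxE; apply: le_trans (normc_sum _ _ _) _.
apply: ler_sum => l _; rewrite normcM ler_wpM2r ?normc_ge0 //; apply: h.
(* As s < N, the exponent N + M - s.+1 is at least M: the M idle steps push every contribution into
   the tail. *)
apply: leq_trans (leq_addl _ _).
by rewrite -addnBAC ?leq_addl.
Qed.

End Periodization.

Lemma sdp_lower_bound n m p (A : 'M[K]_n) (B : 'M[K]_(n, m))
    (C : 'M[K]_(p, n)) (D : 'M[K]_(p, m)) (k N : nat) (w : nat -> 'cV[K]_m)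
    (x : nat -> 'cV[K]_n) (a eps : R) :
  stable (transfer A B C D) -> (0 < N)%N ->
  (forall j, x j.+1 = A *m x j + B *m w j) -> x 0%N = 0 ->
  0 <= a -> a * \sum_(j < N) sqnorm (w j) <= 1 ->
  (\sum_i Num.sqrt (a * \sum_(j < N) normc (w j i 0) ^+ 2)) ^+ 2 <= k%:R ->
  0 < eps ->
  exists X Q W, sdp_feasible A B k X Q W /\
    a * (\sum_(j < N) sqnorm (output C D w x j)) - eps <= sdp_objective C D X Q W.
Proof.
move=> st N0 hx x0 a0 hw hk eps0.
pose Y : R := \sum_(j < N) \sum_i normc (output C D w x j i 0).
have Y0 : 0 <= Y by do 2!(apply: sumr_ge0 => ? _); exact: normc_ge0.
pose V : R := \sum_(s < N) \sum_l normc (w s l 0).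
have V0 : 0 <= V by do 2!(apply: sumr_ge0 => ? _); exact: normc_ge0.
have den0 : 0 < 2 * a * V * Y + 1 by rewrite ltr_wpDl ?mulr_ge0.
(* The total perturbation will be d (2 a V Y), hence at most [eps]; the 1 keeps the denominator
   positive. *)
pose d := eps / (2 * a * V * Y + 1).
have d0 : 0 < d by rewrite divr_gt0.
(* The threshold [M] also serves as the idle time, and the bound is then used with period N + M. *)
have [M hM] := periodic_resolvent_bound st d0.
have [c [Z [c1 hZ hS]]] := hM (N + M)%N (leq_trans N0 (leq_addr _ _)).
pose w' := truncated w N.
pose s0 := periodic_start A B w N M Z.
pose x' := trajectory A B w' s0.
have hx' j : x' j.+1 = A *m x' j + B *m w' j by [].
have close : x' (N + M)%N = c *: x' 0%N by exact: periodic_closure hZ.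
exists (gram a (N + M) x' x'), (gram a (N + M) x' w'), (gram a (N + M) w' w'); split.
  apply: (gram_feasible a0 c1 hx' close).
    rewrite (@sum_truncated m w N M _ (fun _ v => sqnorm v)) // => j.
    by rewrite /sqnorm big1 // => i _; rewrite mxE normc0 expr0n.
  suff -> : \sum_i Num.sqrt (a * \sum_(j < N + M) normc (w' j i 0) ^+ 2) =
      \sum_i Num.sqrt (a * \sum_(j < N) normc (w j i 0) ^+ 2) by [].
  apply: eq_bigr => i _.
  rewrite (@sum_truncated m w N M _ (fun _ v => normc (v i 0) ^+ 2)) // => j.
  by rewrite mxE normc0 expr0n.
(* The output energy emitted during the idle steps is nonnegative and is dropped. *)
rewrite sdp_objective_gram big_split_ord /= mulrDr ler_wpDr //.
  by rewrite mulr_ge0 // sumr_ge0 // => j _; exact: sqnorm_ge0.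
have small (j : 'I_N) : sqnorm (output C D w x j)
    - 2 * (d * V) * \sum_i normc (output C D w x j i 0) <= sqnorm (output C D w' x' j).
  rewrite (periodic_output C D M Z hx x0 (ltn_ord j)).
  apply: sqnorm_perturb => i; exact: periodic_start_small hS.
have : \sum_(j < N) (sqnorm (output C D w x j)
    - 2 * (d * V) * \sum_i normc (output C D w x j i 0)) <=
    \sum_(j < N) sqnorm (output C D w' x' j) by apply: ler_sum => j _; exact: small.
rewrite sumrB -mulr_sumr -/Y => /(ler_wpM2l a0); apply: le_trans.
rewrite mulrBr lerD2l lerN2.
have -> : a * (2 * (d * V) * Y) = d * (2 * a * V * Y) by ring.
rewrite /d -mulrA ger_pMr // mulrC ler_pdivrMr // mul1r; lra.
Qed.

(** At a large time N the finite averages satisfy the constraints up to d. Dividing the weight by 1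
    + d makes them exact, so [sdp_lower_bound] applies; d is then sent to 0. *)
Lemma sparse_power_le n m p (A : 'M[K]_n) (B : 'M[K]_(n, m))
    (C : 'M[K]_(p, n)) (D : 'M[K]_(p, m)) (k : nat) w x :
  stable (transfer A B C D) -> (0 < k)%N -> sparse_feasible A B C D k w x ->
  ((pnorm (output C D w x) ^+ 2)%:E <=
    ereal_sup [set v | exists X Q W,
       sdp_feasible A B k X Q W /\ v = (sdp_objective C D X Q W)%:E])%E.
Proof.
move=> st k0 [[wP cP yP] [hx x0 w1 hk]].
set S := ereal_sup _.
have pc0 i : 0 <= pnorm (channel w i) by exact: sqrtr_ge0.
have sum_pc : \sum_i pnorm (channel w i) ^+ 2 = pnorm w ^+ 2.
  have h1 := has_power_cvg wP.
  have h2 := @cvg_sum R _ (index_enum 'I_m) _ _ (fun i => has_power_cvg (cP i)).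
  rewrite -(cvg_lim (@norm_hausdorff _ _) h1) -(cvg_lim (@norm_hausdorff _ _) h2).
  rewrite (_ : (fun N => \sum_i avg_power (channel w i) N) = avg_power w) //.
  by apply/funext => N; rewrite avg_power_channels.
have sqrt_pc : (\sum_i Num.sqrt (avg_power (channel w i) N)) ^+ 2 @[N --> \oo] -->
    (\sum_i pnorm (channel w i)) ^+ 2.
  apply: cvg_sqr; apply: cvg_sum => i.
  exact: (cvg_comp _ _ (cP i) (@sqrt_continuous R _)).
(* Cauchy-Schwarz against the indicator of the active channels: at most k of them, with total power
   at most 1. *)
have card_pc : (\sum_i pnorm (channel w i)) ^+ 2 <= k%:R.
  have -> : \sum_i pnorm (channel w i) =
      \sum_(i | 0 < pnorm (channel w i)) 1 * pnorm (channel w i).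
    rewrite (bigID (fun i => 0 < pnorm (channel w i))) /= [X in _ + X]big1 ?addr0.
      by apply: eq_bigr => i _; rewrite mul1r.
    by move=> i; rewrite -leNgt => h; apply/le_anti; rewrite h pc0.
  set T := \sum_(i | _) _.
  have T0 : 0 <= T by apply: sumr_ge0 => i _; rewrite mul1r.
  have hT := cauchy_schwarz (fun i => 0 < pnorm (channel w i)) (fun=> 1)
    (fun i => pnorm (channel w i)).
  rewrite -/T in hT.
  apply: le_trans (_ : _ <= (Num.sqrt (k%:R) * Num.sqrt 1) ^+ 2) _; last first.
    by rewrite sqrtr1 mulr1 sqr_sqrtr.
  rewrite ler_sqr ?nnegrE ?mulr_ge0 ?sqrtr_ge0 //; apply: le_trans hT _.
  apply: ler_pM; rewrite ?sqrtr_ge0 // ler_wsqrtr //.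
    rewrite expr1n sumr_const ler_nat; apply: leq_trans hk.
    by rewrite /Card cardsE.
  apply: le_trans w1; rewrite -sum_pc [leRHS](bigID (fun i => 0 < pnorm (channel w i))) /=.
  by rewrite lerDl sumr_ge0 // => i _; exact: sqr_ge0.
have step (d : R) : 0 < d ->
    (((pnorm (output C D w x) ^+ 2 - d) / (1 + d) - d)%:E <= S)%E.
  move=> d0.
  have d1 : 0 < 1 + d by rewrite addr_gt0.
  have e1 : \forall N \near \oo, avg_power w N <= 1 + d.
    have lt1 : pnorm w ^+ 2 < 1 + d by lra.
    exact: (cvgr_le _ (has_power_cvg wP) _ lt1).
  have e2 : \forall N \near \oo, (\sum_i Num.sqrt (avg_power (channel w i) N)) ^+ 2
      <= k%:R + d.
    have lt2 : (\sum_i pnorm (channel w i)) ^+ 2 < k%:R + d by lra.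
    exact: (cvgr_le _ sqrt_pc _ lt2).
  have e3 : \forall N \near \oo, pnorm (output C D w x) ^+ 2 - d <= avg_power (output C D w x) N.
    have lt3 : pnorm (output C D w x) ^+ 2 - d < pnorm (output C D w x) ^+ 2 by lra.
    exact: (cvgr_ge _ (has_power_cvg yP) _ lt3).
  near \oo => N.
  have N0 : (0 < N)%N by near: N; exists 1%N.
  pose a : R := N%:R^-1 / (1 + d).
  have a0 : 0 <= a by rewrite divr_ge0 ?invr_ge0 // ltW.
  have aE t : a * t = (N%:R^-1 * t) / (1 + d).
    by rewrite /a mulrAC.
  have hw : a * \sum_(j < N) sqnorm (w j) <= 1.
    rewrite aE -avg_powerE ler_pdivrMr // mul1r; near: N; exact: e1.
  have chE i : a * \sum_(j < N) normc (w j i 0) ^+ 2 = avg_power (channel w i) N / (1 + d).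
    rewrite aE avg_powerE; congr (_ * _ / _).
    by apply: eq_bigr => j _; rewrite sqnorm_channel.
  have hkN : (\sum_i Num.sqrt (a * \sum_(j < N) normc (w j i 0) ^+ 2)) ^+ 2 <= k%:R.
    under eq_bigr do rewrite chE sqrtrM ?avg_power_ge0 //.
    have i0 : 0 <= (1 + d)^-1 by rewrite invr_ge0 ltW.
    rewrite -mulr_suml exprMn sqr_sqrtr // ler_pdivrMr //.
    apply: le_trans (_ : k%:R + d <= _); first by near: N; exact: e2.
    (* The scaling absorbs the slack since k + d <= k (1 + d), where k >= 1 enters. *)
    by rewrite mulrDr mulr1 lerD2l; apply: ler_peMl; [exact: ltW | rewrite ler1n].
  have [X [Q [W [hF hO]]]] := sdp_lower_bound st N0 hx x0 a0 hw hkN d0.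
  apply: le_trans (_ : (sdp_objective C D X Q W)%:E <= _)%E; last first.
    by apply: ereal_sup_ubound; exists X, Q, W.
  rewrite lee_fin; apply: le_trans hO; rewrite lerD2r aE -avg_powerE.
  rewrite ler_pM2r ?invr_gt0 //; near: N; exact: e3.
case: S step => [r||] step; last 2 first.
- by rewrite leey.
- by have := step 1 ltr01.
rewrite lee_fin leNgt; apply/negP => lt_r.
set y := pnorm _ ^+ 2 in lt_r step.
have r3 : 0 < `|r| + 3 by rewrite ltr_wpDl.
(* For d <= 1, [step] yields y - r <= 2 d + d r + d^2 <= d (|r| + 3), and this d makes the right
   side at most (y - r) / 2, contradicting r < y. *)
pose d := Num.min 1 ((y - r) / (2 * (`|r| + 3))).
have d0 : 0 < d by rewrite lt_min ltr01 divr_gt0 ?subr_gt0 ?mulr_gt0.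
have d1 : d <= 1 by rewrite ge_min lexx.
have dg : d * (`|r| + 3) <= (y - r) / 2.
  have : d <= (y - r) / (2 * (`|r| + 3)) by rewrite ge_min lexx orbT.
  by rewrite invfM mulrA ler_pdivlMr.
have := step d d0; rewrite lee_fin lerBlDr ler_pdivrMr ?addr_gt0 // => h.
have := ler_norm r => hr; have : d * r <= d * `|r| by rewrite ler_wpM2l // ltW.
have : d * d <= d by rewrite ger_pMl.
nra.
Unshelve. all: by end_near. Qed.

Lemma mu_sparse_le_sdp n m p (A : 'M[K]_n) (B : 'M[K]_(n, m))
    (C : 'M[K]_(p, n)) (D : 'M[K]_(p, m)) (k : nat) :
  stable (transfer A B C D) -> (0 < k)%N ->
  (mu_sparse A B C D k <= mu_sdp A B C D k)%E.
Proof.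
move=> st k0; rewrite /mu_sparse /mu_sdp lee_sqrt.
  by apply: ub_ereal_sup => _ [w [x [h ->]]]; exact: sparse_power_le.
(* Comparing the square roots requires a nonnegative semidefinite value, which the zero signal
   provides through [sparse_power_le]. *)
have h0 : sparse_feasible A B C D k (fun=> 0) (fun=> 0).
  have z d : sqnorm (0 : 'cV[K]_d) = 0.
    by rewrite /sqnorm big1 // => i _; rewrite mxE normc0 expr0n.
  have pz d (f : nat -> 'cV[K]_d) : (forall j, f j = 0) -> avg_power f N @[N --> \oo] --> (0 : R).
    move=> f0; apply: avg_power_cvg; apply: cvg_near_cst; apply: nearW => j.
    by rewrite f0 z.
  have pw := pz m (fun=> 0) (fun=> erefl).
  have pc i : avg_power (channel (fun=> 0 : 'cV[K]_m) i) N @[N --> \oo] --> (0 : R).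
    by apply: pz => j; rewrite /channel row0.
  split; split => //.
  - by apply/cvg_ex; exists 0.
  - by move=> i; apply/cvg_ex; exists 0.
  - by apply/cvg_ex; exists 0; apply: pz => j; rewrite /output !mulmx0 addr0.
  - by move=> j; rewrite !mulmx0 addr0.
  - by rewrite (pnorm_cvg pw) sqrtr0 expr0n.
  - rewrite /Card (_ : [set _ | _]%SET = finset.set0) ?cards0 //.
    by apply/setP => i; rewrite !inE (pnorm_cvg (pc i)) sqrtr0 ltxx.
by apply: le_trans (sparse_power_le st k0 h0); rewrite lee_fin sqr_ge0.
Qed.

End Relaxation.

Theorem mainTheorem1 (R : realType) (n m p k : nat)
    (A : 'M[R[i]]_n) (B : 'M[R[i]]_(n, m))
    (C : 'M[R[i]]_(p, n)) (D : 'M[R[i]]_(p, m))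
    (hM : stable (transfer A B C D)) (hk : (1 <= k <= m)%N) :
  (forall (X : 'M[R[i]]_n) (Q : 'M[R[i]]_(n, m)) (W : 'M[R[i]]_m)
      (idx : 'I_k -> 'I_m),
      sdp_optimal A B C D k X Q W -> top_diag W idx ->
      (mu_round A B C D idx <= mu_sparse A B C D k)%E)
  /\ (mu_sparse A B C D k <= mu_sdp A B C D k)%E.
Proof.
split; last by apply: mu_sparse_le_sdp; case/andP: hk.
by move=> X Q W idx _ [idxI _]; exact: mu_round_le.
Qed.
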